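(* There exist (non-elementary) hyperbolic groups $\Gamma$ for which there is a minimal, isometric action of $\Gamma$ on an $\mathbb{R}$-tree $(T,d_T)$ such that: (1) the action is not small; and (2) the stable translation length $\ell_T$ extends continuously to the space of geodesic currents $\mathcal{C}urr(\Gamma)$.
   Context: Hyperbolic groups are Gromov hyperbolic and non-elementary means not virtually cyclic. An $\mathbb{R}$-tree is a geodesic $0$-hyperbolic metric space. An action on an $\mathbb{R}$-tree is minimal if there is no proper non-empty invariant subtree, and small if the stabilizer of every non-degenerate segment (interval) is virtually cyclic. The stable translation length is $\ell_T[x]=\lim_{n\to\infty}\frac1n d_T(p,x^np)$ for $x\in\Gamma$ and any $p\in T$. Geodesic currents: let $\partial\Gamma$ be the Gromov boundary and $\partial^2\Gamma$ the space of unordered pairs of distinct points of $\partial\Gamma$, with the diagonal $\Gamma$-action. A geodesic current is a locally finite $\Gamma$-invariant (Borel) measure on $\partial^2\Gamma$; $\mathcal{C}urr(\Gamma)$ is the space of geodesic currents with the weak$^*$ topology. For a non-torsion element $x\in\Gamma$ with fixed points $x_{\pm\infty}\in\partial\Gamma$, the rational current of $[x]$ is $\eta_{[x]}=\sum_{g\langle x\rangle\in\Gamma/\langle x\rangle}\delta_{\{gx_{-\infty},gx_{+\infty}\}}$. The function $\ell_T$ extends continuously to $\mathcal{C}urr(\Gamma)$ if there is a continuous function $F:\mathcal{C}urr(\Gamma)\to\mathbb{R}$ with $F(\lambda\eta_{[x]})=\lambda\,\ell_T[x]$ for all $\lambda>0$ and all non-torsion $x\in\Gamma$. *)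

(* Defs.v *)
From HB Require Import structures.
From mathcomp Require Import all_boot all_order all_algebra.
From mathcomp Require Import all_classical all_reals all_analysis.

Set Implicit Arguments.
Unset Strict Implicit.
Unset Printing Implicit Defensive.

Import Order.TTheory GRing.Theory Num.Theory.
Import numFieldNormedType.Exports.

Local Open Scope classical_set_scope.
Local Open Scope ring_scope.

Section Metric.
Context {R : realType} {X : Type} (d : X -> X -> R).

Definition gromov_product (p x y : X) : R := (d p x + d p y - d x y) / 2.

(* Gromov's four-point condition *)
Definition delta_hyperbolic (delta : R) : Prop :=
  forall p x y z : X,
    Order.min (gromov_product p x y) (gromov_product p y z) - delta
      <= gromov_product p x z.

Definition geodesic (a b : X) (c : R -> X) : Prop :=
  [/\ c 0 = a, c (d a b) = b &
      forall s t, s \in `[0, d a b] -> t \in `[0, d a b] ->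
        d (c s) (c t) = `|s - t|].

Definition geodesic_image (a b : X) (c : R -> X) : set X :=
  c @` [set` `[0, d a b]].

Definition geodesic_set (A : set X) : Prop :=
  forall a b, A a -> A b ->
    exists2 c, geodesic a b c & geodesic_image a b c `<=` A.

Definition segment_nd (I : set X) : Prop :=
  exists (a b : X) (c : R -> X),
    [/\ a <> b, geodesic a b c & I = geodesic_image a b c].

End Metric.

Section Groups.
Context {G : groupType}.
Implicit Types (S : seq G) (H : set G).

Definition cyclic_subgroup (x : G) : set G :=
  [set y | exists n : nat, y = (x ^+ n)%g \/ y = (x ^- n)%g].

Definition left_coset (H : set G) (g : G) : set G := [set (g * h)%g | h in H].

(* For a subgroup [H]: some cyclic subgroup has finite index in [H]. *)
Definition virtually_cyclic (H : set G) : Prop :=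
  exists2 x, H x & finite_set [set left_coset (cyclic_subgroup x) h | h in H].

Definition torsion (x : G) : Prop := exists2 n : nat, (0 < n)%N & (x ^+ n)%g = 1%g.

Definition words S (g : G) : set (seq G) :=
  [set w | {subset w <= S ++ [seq (s^-1)%g | s <- S]}
           /\ (\prod_(s <- w) s)%g = g].

Definition generates S : Prop := forall g, words S g !=set0.

(* If [S] generates, this infimum is a minimum; [inf set0 = 0] otherwise. *)
Definition word_length (R : realType) S (g : G) : R :=
  inf [set (size w)%:R | w in words S g].

Definition word_dist (R : realType) S (x y : G) : R :=
  word_length R S (x^-1 * y)%g.

Definition hyperbolic_group (R : realType) S : Prop :=
  generates S /\ exists delta : R, delta_hyperbolic (word_dist R S) delta.

End Groups.

Lemma sval_inj (T : Type) (P : T -> Prop) : injective (@sval T P).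
Proof. by move=> x y; apply: eq_sig_hprop => z; exact: Prop_irrelevance. Qed.

Section Boundary.
Context (R : realType) (G : groupType) (S : seq G).
Implicit Types (u v : nat -> G).

Local Notation gp := (gromov_product (word_dist R S)).

(* [(u_i | v_j)_p] tends to infinity.  For a word metric this does not depend
   on the base point [p]; quantifying over [p] makes the invariance under
   translations immediate. *)
Definition asymptotic u v : Prop :=
  forall (p : G) (M : R), \forall i & j \near \oo, M <= gp p (u i) (v j).

Definition boundary_class u : set (nat -> G) :=
  [set v | asymptotic v v /\ asymptotic u v].

(* The Gromov boundary, as the set of classes of sequences of group elements
   (vertices of the Cayley graph) converging to infinity *)
Definition boundary : Type :=
  {xi : set (nat -> G) |
    exists2 u, asymptotic u u & xi = boundary_class u}.

HB.instance Definition _ := gen_eqMixin boundary.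
HB.instance Definition _ := gen_choiceMixin boundary.

(* The basic neighbourhoods {eta | (xi | eta)_1 >= r}, in the form: some
   representatives satisfy [liminf_(i, j) (u_i | v_j)_1 >= r].  The products are
   half-integers, so this says that eventually [(u_i | v_j)_1 >= r]. *)
Definition boundary_ball (xi : boundary) (r : R) : set boundary :=
  [set eta | exists u v, [/\ sval xi u, sval eta v &
     \forall i & j \near \oo, r <= gp 1%g (u i) (v j)]].

Definition boundary_open : set (set boundary) :=
  [set U | forall xi, U xi -> exists r : R, boundary_ball xi r `<=` U].

Let boundary_openT : boundary_open setT.
Proof. by move=> xi _; exists 0. Qed.

Let boundary_ball_le xi r s : r <= s -> boundary_ball xi s `<=` boundary_ball xi r.
Proof.
move=> rs eta [u [v [xu ev uv]]]; exists u, v; split => //.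
by apply: filterS uv => ij; exact: le_trans.
Qed.

Let boundary_openI : setI_closed boundary_open.
Proof.
move=> U V oU oV xi [/oU[r rU] /oV[s sV]]; exists (Order.max r s) => eta eB.
by split; [apply: rU|apply: sV]; apply: boundary_ball_le eB;
  rewrite le_max lexx ?orbT.
Qed.

Let boundary_open_bigU (I : Type) (f : I -> set boundary) :
  (forall i, boundary_open (f i)) -> boundary_open (\bigcup_i f i).
Proof.
move=> of_ xi [i _ /of_[r rf]]; exists r => eta /rf; by exists i.
Qed.

HB.instance Definition _ := isOpenTopological.Build boundary
  boundary_openT boundary_openI boundary_open_bigU.

Let gromov_product_mul g p x y : gp p (g * x)%g (g * y)%g = gp (g^-1 * p)%g x y.
Proof.
rewrite /gromov_product /word_dist.
by rewrite !invgM !invgK !mulgA; congr ((_ + _ - word_length _ _ _) / _);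
  rewrite -!mulgA mulKg.
Qed.

Let asymptotic_mul g u v :
  asymptotic (fun n => g * u n)%g (fun n => g * v n)%g <-> asymptotic u v.
Proof.
split=> uv p M.
  have := uv (g * p)%g M; apply: filterS => -[i j] /=.
  by rewrite gromov_product_mul mulKg.
have := uv (g^-1 * p)%g M; apply: filterS => -[i j] /=.
by rewrite gromov_product_mul.
Qed.

Let translate_class g (xi : boundary) : exists2 u, asymptotic u u &
  (fun u n => g * u n)%g @` sval xi = boundary_class u.
Proof.
case: xi => _ /= [u uu ->]; exists (fun n => g * u n)%g.
  exact/asymptotic_mul.
apply/seteqP; split=> [_ [v [vv uv] <-]|v [vv uv]].
  by split; exact/asymptotic_mul.
pose w n := (g^-1 * v n)%g.
have vE : (fun n => g * w n)%g = v by apply/funext => n; exact: mulVKg.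
exists w; last exact: vE.
have := asymptotic_mul g w w; rewrite vE => -[/(_ vv) ww _].
by have := asymptotic_mul g u w; rewrite vE => -[/(_ uv) uw _].
Qed.

Definition boundary_act (g : G) (xi : boundary) : boundary :=
  exist _ ((fun u n => g * u n)%g @` sval xi) (translate_class g xi).

Let boundary_actK g : cancel (boundary_act g) (boundary_act g^-1%g).
Proof.
move=> xi; apply: sval_inj => /=.
rewrite image_comp -[RHS]image_id; apply: eq_imagel => u _ /=.
by apply/funext => n; rewrite mulKg.
Qed.

Definition boundary2 : Type :=
  {e : set boundary | exists xi eta, xi <> eta /\ e = [set xi; eta]}.

HB.instance Definition _ := gen_eqMixin boundary2.
HB.instance Definition _ := gen_choiceMixin boundary2.

Definition off_diagonal : set (boundary * boundary) := [set p | p.1 <> p.2].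

Definition ordered_pairs (U : set boundary2) : set (boundary * boundary) :=
  [set p | exists2 e, U e & sval e = [set p.1; p.2]].

(* Quotient topology of the subspace topology on the ordered pairs *)
Definition boundary2_open : set (set boundary2) :=
  [set U | exists2 V : set (boundary * boundary),
     open V & ordered_pairs U = V `&` off_diagonal].

Let pair_neq (e : boundary2) x y : sval e = [set x; y] -> x <> y.
Proof.
case: e => _ /= [a [b [ab ->]]] E xy; apply: ab; rewrite -{}xy setUid in E.
have /= -> : [set x] a by rewrite -E; left.
by have /= -> : [set x] b by rewrite -E; right.
Qed.

Let boundary2_openT : boundary2_open setT.
Proof.
exists setT; first exact: openT.
rewrite setTI; apply/seteqP; split=> [[x y] [e _]/= /pair_neq//|[x y] /= xy].
by unshelve eexists (exist _ [set x; y] _) => //=; exists x, y.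
Qed.

Let boundary2_openI : setI_closed boundary2_open.
Proof.
move=> U V [U' oU' UE] [V' oV' VE]; exists (U' `&` V'); first exact: openI.
rewrite -(setIid off_diagonal) setIACA -UE -VE.
apply/seteqP; split=> [p [e [Ue Ve] ep]|p [[e Ue ep] [f Vf fp]]].
  by split; exists e.
have ef : e = f by apply: sval_inj; rewrite ep fp.
by exists e => //; split => //; rewrite ef.
Qed.

Let boundary2_open_bigU (I : Type) (f : I -> set boundary2) :
  (forall i, boundary2_open (f i)) -> boundary2_open (\bigcup_i f i).
Proof.
move=> of_; have /choice[V VP] i : exists V : set (boundary * boundary),
    open V /\ ordered_pairs (f i) = V `&` off_diagonal.
  by have [V] := of_ i; exists V.
exists (\bigcup_i V i); first by apply: bigcup_open => i _; have [] := VP i.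
rewrite setI_bigcupl; under [RHS]eq_bigcupr do rewrite -(VP _).2.
apply/seteqP; split=> [p [e [i _ fe] ep]|p [i _ [e fe ep]]].
  by exists i => //; exists e.
by exists e => //; exists i.
Qed.

HB.instance Definition _ := isOpenTopological.Build boundary2
  boundary2_openT boundary2_openI boundary2_open_bigU.

Let translate_pair g (e : boundary2) : exists xi eta,
  xi <> eta /\ boundary_act g @` sval e = [set xi; eta].
Proof.
case: e => _ /= [a [b [ab ->]]]; exists (boundary_act g a), (boundary_act g b).
by split; [move/(can_inj (boundary_actK g))|rewrite image_setU !image_set1].
Qed.

Definition boundary2_act (g : G) (e : boundary2) : boundary2 :=
  exist _ (boundary_act g @` sval e) (translate_pair g e).

(* The set of fixed points of [x] on the boundary is [e]; for [x] non-torsion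
   in a hyperbolic group there is exactly one such pair. *)
Definition fixed_pair (x : G) (e : boundary2) : Prop :=
  sval e = [set xi | boundary_act x xi = xi].

End Boundary.

(* The library requires measurable types to be inhabited by a distinguished
   point; this is the only role of the parameter [e0]. *)

Section BorelBoundary2.
Context (R : realType) (G : groupType) (S : seq G).

Definition pboundary2 (e0 : boundary2 R S) : Type := boundary2 R S.

HB.instance Definition _ e0 := Topological.on (pboundary2 e0).
HB.instance Definition _ e0 := isPointed.Build (pboundary2 e0) e0.

Definition borel_boundary2 (e0 : boundary2 R S) : Type :=
  g_sigma_algebraType (@open (pboundary2 e0)).

HB.instance Definition _ e0 := Measurable.on (borel_boundary2 e0).

End BorelBoundary2.

Section Currents.
Context (R : realType) (G : groupType) (S : seq G) (e0 : boundary2 R S).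

Local Notation B2 := (borel_boundary2 e0).

Definition locally_finite (mu : {measure set B2 -> \bar R}) : Prop :=
  forall e : boundary2 R S,
    exists2 U : set (boundary2 R S), open_nbhs e U & (mu U < +oo)%E.

Definition invariant_measure (mu : {measure set B2 -> \bar R}) : Prop :=
  forall (g : G) (A : set B2), measurable A ->
    mu (@boundary2_act R G S g @^-1` A) = mu A.

Definition current : Type :=
  {mu : {measure set B2 -> \bar R} | locally_finite mu /\ invariant_measure mu}.

HB.instance Definition _ := gen_eqMixin current.
HB.instance Definition _ := gen_choiceMixin current.

Definition Cc : Type :=
  {f : boundary2 R S -> R |
    continuous f /\ compact (closure [set e | f e != 0])}.

Definition pairing (mu : current) : {ptws Cc -> R} :=
  fun f => \int[sval mu]_(e in [set: B2]) sval f e.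

(* The weak* topology: the coarsest one making every
   [mu |-> \int[mu]_e f e], [f : Cc], continuous *)
HB.instance Definition _ :=
  Topological.copy current (initial_topology pairing).

(* [mu = lambda *: eta_[x]], the sum being over the left cosets of <x>; its
   terms do not depend on the representatives since [x] fixes [e]. *)
Definition scaled_rational_current (x : G) (lambda : R) (mu : current) : Prop :=
  exists2 e : boundary2 R S, fixed_pair x e &
    forall A : set B2, measurable A ->
      sval mu A = (lambda%:E *
        \esum_(C in range (left_coset (cyclic_subgroup x)))
          dirac (boundary2_act (xget 1%g C) e : B2) A)%E.

End Currents.

Section Actions.
Context {R : realType} {G : groupType} {T : metricType R}.

Definition Rtree (U : metricType R) : Prop :=
  geodesic_set (@mdist R U) [set: U] /\ delta_hyperbolic (@mdist R U) 0.

(* [0]-hyperbolicity passes to subsets. *)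
Definition subtree (A : set T) : Prop := geodesic_set (@mdist R T) A.

Variable to : G -> T -> T.

Definition isometric_action : Prop :=
  [/\ forall p, to 1%g p = p,
      forall g h p, to (g * h)%g p = to g (to h p) &
      forall g p q, mdist (to g p) (to g q) = mdist p q].

Definition minimal_action : Prop :=
  forall A : set T, subtree A -> A !=set0 -> (forall g, to g @` A `<=` A) ->
    A = setT.

(* Setwise; the pointwise stabilizer of a segment has index at most 2 in it, so
   both readings give the same small actions. *)
Definition stabilizer (I : set T) : set G := [set g | to g @` I = I].

Definition small_action : Prop :=
  forall I : set T, segment_nd (@mdist R T) I ->
    virtually_cyclic (stabilizer I).

Definition stable_length (p : T) (x : G) : R :=
  lim ((mdist p (to (x ^+ n)%g p) / n%:R) @[n --> \oo]).

(* For each [lambda > 0] and non-torsion [x], [lambda *: eta_[x]] is a current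
   and [F] has the prescribed value there. *)
Definition extends_to_currents (S : seq G) : Prop :=
  exists (e0 : boundary2 R S) (F : current e0 -> R),
    continuous F /\
    forall (lambda : R) (x : G), 0 < lambda -> ~ torsion x ->
      exists2 mu : current e0, scaled_rational_current x lambda mu &
        forall p : T, F mu = lambda * stable_length p x.

End Actions.

(* Main.v *)
From HB Require Import structures.
Require Import Defs.
From mathcomp Require Import all_boot all_order all_algebra.
From mathcomp Require Import all_classical all_reals all_analysis.
From mathcomp Require Import zify lra.

Set Implicit Arguments.
Unset Strict Implicit.
Unset Printing Implicit Defensive.

Import Order.TTheory GRing.Theory Num.Theory.
Import numFieldNormedType.Exports.

(** The group is the free product [cox letter] of five groups of order two. Its
    Cayley graph is a tree, so it is hyperbolic; its elements are the words
    without two equal consecutive letters. Three letters, the neutral ones,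
    generate a subgroup [C]; the other two, [a] and [b], have the colours
    [false] and [true]. The group is the amalgam of [<a, C>] and [<b, C>] over
    [C], and the tree is the Bass-Serre tree of this splitting: one orbit of
    edges of length one, whose stabilizers are the conjugates of [C]. As [C] is
    a free product of three groups of order two, the action is not small. In
    terms of words, the distance between the points of parameters [s] and [t] on
    the edges [g] and [h] is the length of the path on the real line from [s] to
    [t] through the positions, 0 or 1, of the coloured letters of [g^-1 h];
    neutral letters cost nothing ([tdist]). That this is a tree follows from the
    four-point condition on the line, applied where the geodesics of the Cayley
    tree branch ([four_arms], [tdist_two_largest]).

    The translation length of an element is the number of colour changes of its
    cyclically reduced word, read cyclically ([stable_length_axis]). On the axis
    of the element in the Cayley tree, a colour change is a subword [a c b] or
    [b c a] with [c] neutral, so the number of changes per period is the mass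
    which the rational current gives to the set [lines crossing] of the lines
    through [1] on which one of the two directions starts with such a subword [a
    c b] ([count_lines], [cyclic_length_crossing]). The extension to currents is
    therefore the mass of this set ([crossing_mass]).

    The set is not compact, since [c] may be arbitrarily long, so continuity has
    to be proved. Bounding the length of [c] by [2n] gives a compact open set,
    whose mass is weak* continuous. What is lost lies in the set of lines which
    follow [a] and then [2n] neutral letters. The translates of this set by the
    first [n] vertices of the neutral run have the same mass, by invariance;
    they are disjoint and contained in the compact open set of lines through
    [1]. So the loss is at most [1/n] times the mass of the latter set
    ([long_run_bound]), and [crossing_mass] is a locally uniform limit of
    continuous functions. *)

(** * Reduced words and the free product of groups of order two *)

Section Words.
Context {L : finType}.
Implicit Types (x y : L) (u v w : seq L).

Definition reduced w := sorted (fun x y => x != y) w.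

(** No cancellation happens when the inverse [rev u] of [u] is multiplied by
    [v]. *)
Definition diverge u v :=
  match u, v with x :: _, y :: _ => x != y | _, _ => true end.

Definition push x w :=
  if w is y :: w' then if x == y then w' else x :: w else [:: x].

Definition rmul u v := foldr push v u.

Lemma divergeC u v : diverge u v = diverge v u.
Proof. by case: u v => [|x u] [|y v] //=; rewrite eq_sym. Qed.

Lemma diverges0 u : diverge u [::]. Proof. by case: u. Qed.

Lemma diverge_catl u u' v : u != [::] -> diverge (u ++ u') v = diverge u v.
Proof. by case: u. Qed.

Lemma diverge_catr u v v' : v != [::] -> diverge u (v ++ v') = diverge u v.
Proof. by case: v. Qed.

Lemma reduced_cons x w : reduced (x :: w) = diverge [:: x] w && reduced w.
Proof. by case: w. Qed.

Lemma reduced_cat u v :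
  reduced (u ++ v) = [&& reduced u, reduced v & diverge (rev u) v].
Proof.
elim: u => [|x u IH]; first by rewrite andbT.
rewrite cat_cons !reduced_cons IH rev_cons -cats1.
case: u {IH} => [|y u]; first by rewrite /= andbT andbC.
by rewrite -!andbA rev_cons -cats1 -catA; case: (rev u).
Qed.

Lemma reduced_rev w : reduced (rev w) = reduced w.
Proof.
rewrite /reduced rev_sorted; case: w => //= x w.
by apply: eq_path => ??; rewrite eq_sym.
Qed.

Lemma reduced_take n w : reduced w -> reduced (take n w).
Proof. by rewrite -{1}(cat_take_drop n w) reduced_cat => /andP[]. Qed.

Lemma push_reduced x w : reduced w -> reduced (push x w).
Proof.
case: w => //= y w; case: ifP => [_|xy] rw; first exact: path_sorted rw.
by rewrite /= xy.
Qed.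

Lemma pushK x w : reduced w -> push x (push x w) = w.
Proof.
case: w => /= [|y w]; first by rewrite eqxx.
case: eqP => [<-|_ _]; last by rewrite /= eqxx.
by case: w => //= z w /andP[xz _]; rewrite (negPf xz).
Qed.

Lemma rmul_reduced u v : reduced v -> reduced (rmul u v).
Proof. by move=> rv; elim: u => //= x u; apply: push_reduced. Qed.

Lemma rmul_cat u v w : rmul (u ++ v) w = rmul u (rmul v w).
Proof. exact: foldr_cat. Qed.

Lemma rmul_id u v : reduced (u ++ v) -> rmul u v = u ++ v.
Proof.
elim: u => //= x u IH ruv; rewrite IH; last exact: path_sorted ruv.
by case: (u ++ v) ruv => //= y w /andP[/negPf->].
Qed.

Lemma rmul_push x u v : reduced v -> rmul (push x u) v = push x (rmul u v).
Proof.
by case: u => //= y u rv; case: eqP => //= ->; rewrite pushK// rmul_reduced.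
Qed.

Lemma rmulA u v w : reduced w -> rmul (rmul u v) w = rmul u (rmul v w).
Proof. by move=> rw; elim: u => //= x u IH; rewrite rmul_push// IH. Qed.

Lemma rmul_revK u v : rmul (rev u) (u ++ v) = v.
Proof. by elim: u v => //= x u IH v; rewrite rev_cons -cats1 rmul_cat /= eqxx. Qed.

Lemma size_push x w : (size (push x w) <= (size w).+1)%N.
Proof. by case: w => //= y w; case: ifP => //= _; lia. Qed.

Lemma size_rmul u v : (size (rmul u v) <= size u + size v)%N.
Proof. by elim: u => //= x u IH; apply: leq_trans (size_push _ _) _; lia. Qed.

(** Where two words part: afterwards [rev u' ++ v'] is the reduced form of [u^-1
    v]. *)
Lemma common_prefix u v :
  exists p u' v', [/\ u = p ++ u', v = p ++ v' & diverge u' v'].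
Proof.
elim: u v => [|x u IH] [|y v]; [by exists [::], [::], [::]|
  by exists [::], [::], (y :: v)|by exists [::], (x :: u), [::]|].
have [<-|xy] := eqVneq x y; last by exists [::], (x :: u), (y :: v).
by have [p [u' [v' [-> -> d]]]] := IH v; exists (x :: p), u', v'.
Qed.

End Words.

Arguments reduced : simpl never.

(** The free product of copies of the group of order two indexed by [L]: the
    letters are involutions, so that inverting a word means reversing it. *)
Record cox (L : finType) := Cox { word :> seq L; word_reduced : reduced word }.

Arguments Cox {L}.

HB.instance Definition _ (L : finType) := [isSub for @word L].
HB.instance Definition _ (L : finType) := [Choice of cox L by <:].

Section CoxeterGroup.
Context {L : finType}.
Implicit Types (x y : L) (u v w : seq L) (g h k : cox L).

Lemma cox_inj g h : word g = word h -> g = h.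
Proof. exact: val_inj. Qed.

Definition cox1 : cox L := Cox [::] isT.

Definition coxM g h : cox L := Cox _ (rmul_reduced g (word_reduced h)).

Fact rev_word_reduced g : reduced (rev g).
Proof. by rewrite reduced_rev word_reduced. Qed.

Definition coxV g : cox L := Cox _ (rev_word_reduced g).

Let coxMA : associative coxM.
Proof. by move=> g h k; apply: cox_inj; rewrite /= rmulA// word_reduced. Qed.

Let cox1M : left_id cox1 coxM.
Proof. by move=> g; apply: cox_inj. Qed.

Let coxM1 : right_id cox1 coxM.
Proof. by move=> g; apply: cox_inj; rewrite /= rmul_id cats0 ?word_reduced. Qed.

Let coxVM : left_inverse cox1 coxV coxM.
Proof. by move=> g; apply: cox_inj; rewrite /= -{2}(cats0 g) rmul_revK. Qed.

Let coxMV : right_inverse cox1 coxV coxM.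
Proof.
move=> g; apply: cox_inj.
by rewrite /= -{1}(revK g) -{2}(cats0 (rev g)) rmul_revK.
Qed.

HB.instance Definition _ := isGroup.Build (cox L) coxMA cox1M coxM1 coxVM coxMV.

Local Open Scope group_scope.

Lemma wordM g h : word (g * h) = rmul g h. Proof. by []. Qed.
Lemma wordV g : word g^-1 = rev g. Proof. by []. Qed.

Definition gen x : cox L := Cox [:: x] isT.

Definition gens : seq (cox L) := [seq gen x | x <- enum L].

Lemma genV x : (gen x)^-1 = gen x. Proof. exact: cox_inj. Qed.

Lemma word_genM x g : word (gen x * g) = push x g. Proof. by []. Qed.

Lemma word_ldiv g h (p u v : seq L) : word g = p ++ u -> word h = p ++ v ->
  diverge u v -> word (g^-1 * h) = rev u ++ v.
Proof.
move=> gE hE d; rewrite wordM wordV gE hE rev_cat rmul_cat rmul_revK rmul_id//.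
have := word_reduced g; have := word_reduced h; rewrite gE hE !reduced_cat.
by move=> /and3P[_ -> _] /and3P[_ ru _]; rewrite reduced_rev ru revK.
Qed.

Definition of_word u : cox L := \prod_(x <- u) gen x.

Lemma word_of_word u : word (of_word u) = rmul u [::].
Proof.
by rewrite /of_word; elim: u => [|x u IH]; rewrite ?big_nil// big_cons wordM IH.
Qed.

Lemma of_wordK g : of_word g = g.
Proof. by apply: cox_inj; rewrite word_of_word rmul_id cats0 ?word_reduced. Qed.

Lemma of_word_cat u v : of_word (u ++ v) = of_word u * of_word v.
Proof. exact: big_cat. Qed.

Lemma of_word_red u : reduced u -> word (of_word u) = u.
Proof. by move=> ru; rewrite word_of_word rmul_id cats0. Qed.

Lemma of_word_rev u : of_word (rev u) = (of_word u)^-1.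
Proof.
elim: u => [|x u IH]; first by rewrite /of_word big_nil invg1.
rewrite rev_cons -cats1 of_word_cat IH (of_word_cat [:: x] u) invgM.
by rewrite /of_word !big_seq1 genV.
Qed.

Lemma cox_invol g : (size g <= 1)%N -> torsion g.
Proof.
move=> sg; exists 2 => //; apply: cox_inj; rewrite expg2 wordM.
by case: (word g) sg => [|x [|]]//= _; rewrite eqxx.
Qed.

Lemma torsionJ g h : torsion (g^-1 * h * g) -> torsion h.
Proof.
case=> n n0 e; exists n => //; move: e.
have -> : (g^-1 * h * g) ^+ n = g^-1 * h ^+ n * g.
  by rewrite -!mulgA -!conjgE conjXg.
by move/(congr1 (fun z => g * z * g^-1)); rewrite mulg1 mulgV !mulgA mulgV mul1g mulgK.
Qed.

(** Elements of infinite order are conjugate to cyclically reduced ones: a word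
    beginning and ending with the same letter gets shorter by conjugation. *)
Lemma cyclically_reduced g : ~ torsion g ->
  exists h z, [/\ g = h * z * h^-1, word z != [::] & diverge (rev z) z].
Proof.
have [n] := ubnP (size g); elim: n g => // n IH g sg tg.
have [d|] := boolP (diverge (rev g) g).
  exists 1, g; rewrite mul1g invg1 mulg1; split=> //.
  by apply/eqP => g0; apply: tg; apply: cox_invol; rewrite g0.
case gE: (word g) => [//|x u]; rewrite -gE => d.
have : exists w, word g = x :: rcons w x.
  move: d; rewrite gE; case/lastP: u {gE} (gE) => [gE|w y gE].
    by move=> _; exfalso; apply: tg; apply: cox_invol; rewrite gE.
  by rewrite -rcons_cons rev_rcons /= negbK => /eqP->; exists w.
case=> w gw; have rw : reduced w.
  have := word_reduced g; rewrite gw -rcons_cons -cats1 reduced_cat reduced_cons.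
  by case/andP => /andP[].
have gE' : g = gen x * of_word w * (gen x)^-1.
  rewrite genV -[LHS]of_wordK gw -cat1s -cats1 !of_word_cat mulgA.
  by rewrite /of_word !big_seq1.
have := IH (of_word w); case.
  by rewrite of_word_red//; move: sg; rewrite gw /= size_rcons; lia.
  by move=> tw; apply: tg; apply: (@torsionJ (gen x)); rewrite gE' !mulgA mulgVK mulVg mul1g.
by move=> h [z [wE z0 d']]; exists (gen x * h), z; split=> //; rewrite gE' wE invgM !mulgA.
Qed.

End CoxeterGroup.

Local Open Scope classical_set_scope.
Local Open Scope ring_scope.

(** * The Cayley tree *)

Section CayleyTree.
Context {R : realType} {L : finType}.
Implicit Types (x y : L) (u v w : seq L) (g h k p : cox L).

Local Notation gens := (@gens L).
Local Notation dist := (word_dist R gens).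
Local Notation gp := (gromov_product dist).

Lemma mem_gens s : s \in gens ++ [seq (t^-1)%g | t <- gens] -> exists x, s = gen x.
Proof.
rewrite mem_cat => /orP[/mapP[x _ ->]|/mapP[_ /mapP[x _ ->] ->]]; first by exists x.
by exists x; rewrite genV.
Qed.

Lemma words_of_word g : words gens g [seq gen x | x <- word g].
Proof.
split; last by rewrite big_map; exact: of_wordK.
by move=> _ /mapP[x _ ->]; rewrite mem_cat map_f ?mem_enum.
Qed.

Lemma cox_generated : generates gens.
Proof. by move=> g; exists [seq gen x | x <- word g]; apply: words_of_word. Qed.

Lemma word_lengthE g : word_length R gens g = (size g)%:R.
Proof.
have mem : [set (size w)%:R | w in words gens g] ((size g)%:R : R).
  by exists [seq gen x | x <- word g]; [exact: words_of_word|rewrite size_map].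
have lb : lbound [set (size w)%:R | w in words gens g] ((size g)%:R : R).
  move=> _ [w [wS <-] <-]; rewrite ler_nat.
  elim: w wS => [|s w IH] wS; first by rewrite big_nil.
  have [x ->] := mem_gens (wS s (mem_head _ _)).
  rewrite big_cons word_genM (leq_trans (size_push _ _))// ltnS.
  by apply: IH => t tw; apply: wS; rewrite inE tw orbT.
apply/eqP; rewrite eq_le; apply/andP; split; last exact: lb_le_inf (ex_intro _ _ mem) lb.
by apply: ge_inf mem; exists (size g)%:R.
Qed.

Lemma distE g h : dist g h = (size (g^-1 * h)%g)%:R.
Proof. exact: word_lengthE. Qed.

Lemma distM k g h : dist (k * g)%g (k * h)%g = dist g h.
Proof. by rewrite !distE invgM mulgA mulgVK. Qed.

Lemma dist_triangle g h k : dist g k <= dist g h + dist h k.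
Proof.
rewrite !distE -natrD ler_nat.
have -> : (g^-1 * k = (g^-1 * h) * (h^-1 * k))%g by rewrite mulgA mulgK.
exact: size_rmul.
Qed.

Lemma gpM k p g h : gp (k * p)%g (k * g)%g (k * h)%g = gp p g h.
Proof. by rewrite /gromov_product !distM. Qed.

Lemma gp_base p g h : gp p g h = gp 1%g (p^-1 * g)%g (p^-1 * h)%g.
Proof. by rewrite -(gpM p^-1%g) mulVg. Qed.

(** In a tree the Gromov product is the length of the common initial segment. *)
Lemma gp1E g h (p u v : seq L) : word g = p ++ u -> word h = p ++ v -> diverge u v ->
  gp 1%g g h = (size p)%:R.
Proof.
move=> gE hE d; rewrite /gromov_product !distE invg1 !mul1g.
rewrite (word_ldiv gE hE d) size_cat size_rev.
by rewrite gE hE !size_cat !natrD; lra.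
Qed.

Lemma gp_ge n g h : (n%:R <= gp 1%g g h) =
  [&& (n <= size g)%N, (n <= size h)%N & take n g == take n h].
Proof.
have [p [u [v [gE hE d]]]] := common_prefix g h.
rewrite (gp1E gE hE d) ler_nat gE hE !size_cat.
have [np|pn] := leqP n (size p).
  by rewrite !takel_cat// eqxx andbT; apply/esym/andP; split; lia.
apply/esym/negP => /and3P[gn hn /eqP/esym].
rewrite !take_cat ltnNge (ltnW pn) /=.
case: u {gE} d gn => [|x u] d gn; first by move: gn => /=; lia.
case: v {hE} d hn => [|y v] d hn; first by move: hn => /=; lia.
have /prednK <- : (0 < n - size p)%N by lia.
by move=> /eqP; rewrite eqseq_cat//= => /andP[_ /eqP[yx]]; move: d; rewrite yx /= eqxx.
Qed.

Lemma gp_nat g h : exists n, gp 1%g g h = n%:R.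
Proof.
have [p [u [v [gE hE d]]]] := common_prefix g h.
by exists (size p); apply: gp1E gE hE d.
Qed.

Lemma cayley_tree_hyperbolic : hyperbolic_group R gens.
Proof.
split; first exact: cox_generated.
exists 0 => p x y z; rewrite subr0 !(gp_base p).
set x' := (_ * x)%g; set y' := (_ * y)%g; set z' := (_ * z)%g.
have [m mE] := gp_nat x' y'; have [n nE] := gp_nat y' z'.
rewrite mE nE; have -> : Num.min (m%:R : R) n%:R = (minn m n)%:R.
  by have [mn|/ltnW mn] := leqP m n; [rewrite min_l|rewrite min_r]; rewrite ?ler_nat.
have : (minn m n)%:R <= gp 1%g x' y' by rewrite mE ler_nat geq_minl.
have : (minn m n)%:R <= gp 1%g y' z' by rewrite nE ler_nat geq_minr.
by rewrite !gp_ge => /and3P[_ -> /eqP<-] /and3P[-> _ /eqP->] /=.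
Qed.

Lemma gp_change p g h : gp 1%g g h - dist 1%g p <= gp p g h.
Proof.
rewrite /gromov_product.
have := dist_triangle 1%g p g; have := dist_triangle 1%g p h; lra.
Qed.

End CayleyTree.

(** * Boundary points as infinite reduced words *)

Section InfiniteWords.
Context {L : finType}.
Implicit Types (x y : L) (u v w : seq L) (om : nat -> L).

Definition ireduced om := forall n, om n != om n.+1.

Definition ishift om : nat -> L := fun n => om n.+1.
Definition icons x om : nat -> L := fun n => if n is m.+1 then om m else x.
Definition icat w om := foldr icons om w.
Definition ipush x om := if x == om 0%N then ishift om else icons x om.
(** The action of the group on infinite reduced words, by concatenation and
    cancellation. *)
Definition irmul w om := foldr ipush om w.

Lemma icons_eta om : icons (om 0%N) (ishift om) = om.
Proof. by apply/funext => -[]. Qed.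

Lemma mkseqS_l om n : mkseq om n.+1 = om 0%N :: mkseq (ishift om) n.
Proof. by rewrite /mkseq /= (iotaDl 1 0) -map_comp. Qed.

Lemma take_mkseq om m n : (m <= n)%N -> take m (mkseq om n) = mkseq om m.
Proof. by move=> mn; rewrite -map_take take_iota (minn_idPl mn). Qed.

Lemma mkseq_eqP om om' n : mkseq om n = mkseq om' n <-> forall i, (i < n)%N -> om i = om' i.
Proof.
split=> [E i ni|E].
  by have := congr1 (fun s => nth (om 0%N) s i) E; rewrite !nth_mkseq.
by apply/eq_in_map => i; rewrite mem_iota => /andP[_]; exact: E.
Qed.

Lemma reduced_mkseq om n : ireduced om -> reduced (mkseq om n).
Proof.
move=> r; apply/(sortedP (om 0%N)) => j; rewrite size_mkseq => jn.
by rewrite !nth_mkseq ?(ltnW jn)//; exact: r.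
Qed.

Lemma ireduced_shift om : ireduced om -> ireduced (ishift om).
Proof. by move=> r n; exact: r. Qed.

Lemma ireduced_cons x om : ireduced om -> x != om 0%N -> ireduced (icons x om).
Proof. by move=> r xo []. Qed.

Lemma ipush_reduced x om : ireduced om -> ireduced (ipush x om).
Proof.
move=> r; rewrite /ipush; case: eqP => [_|/eqP xo]; first exact: ireduced_shift.
exact: ireduced_cons.
Qed.

Lemma irmul_reduced w om : ireduced om -> ireduced (irmul w om).
Proof. by move=> r; elim: w => //= x w; exact: ipush_reduced. Qed.

Lemma ipushK x om : ireduced om -> ipush x (ipush x om) = om.
Proof.
move=> r; rewrite {2}/ipush; case: eqP => [->|_].
  by rewrite /ipush ifN ?icons_eta//; exact: r.
by rewrite /ipush /= eqxx.
Qed.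

Lemma irmul_cat u v om : irmul (u ++ v) om = irmul u (irmul v om).
Proof. exact: foldr_cat. Qed.

Lemma irmul_revK u om : irmul (rev u) (icat u om) = om.
Proof.
elim: u => //= x u IH; rewrite rev_cons -cats1 irmul_cat /=.
by rewrite {1}/ipush /= eqxx.
Qed.

Lemma icat_cat u v om : icat (u ++ v) om = icat u (icat v om).
Proof. exact: foldr_cat. Qed.

Lemma icat_nth x0 u om n :
  icat u om n = if (n < size u)%N then nth x0 u n else om (n - size u)%N.
Proof.
elim: u n => [|x u IH] n; first by rewrite /= subn0.
by case: n => //= n; rewrite IH ltnS subSS.
Qed.

Lemma irmul_icat u om : reduced u -> (if rev u is x :: _ then x != om 0%N else true) ->
  irmul u om = icat u om.
Proof.
elim: u => //= x u IH; rewrite reduced_cons => /andP[xu ru].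
rewrite rev_cons -cats1; case: u xu ru IH => [|y u] xu ru IH /=.
  by move=> xo; rewrite /ipush (negPf xo).
rewrite rev_cons -cats1 in IH *; move=> H.
have /= -> := IH ru; last by case: (rev u) H.
by rewrite /ipush /= (negPf xu).
Qed.

(** If [u] is not an initial segment of [om], then cancellation stops inside
    [u^-1 om], which therefore begins like [u^-1]. *)
Lemma irmul_rev_head x u om : ireduced om -> reduced (rcons u x) ->
  rcons u x != mkseq om (size u).+1 -> irmul (rev (rcons u x)) om 0%N = x.
Proof.
elim: u om => [|y u IH] om r.
  by rewrite /= /mkseq /= => _ xo; rewrite /ipush ifN//; apply: contra xo => /eqP->.
rewrite rcons_cons reduced_cons => /andP[yu ru] ne.
rewrite rev_cons -cats1 irmul_cat /=.
have [yo|yo] := eqVneq y (om 0%N).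
  rewrite /ipush -yo eqxx; apply: IH => //; first exact: ireduced_shift.
  by apply: contra ne => /eqP ->; rewrite [mkseq om _]mkseqS_l yo.
rewrite /ipush (negPf yo) irmul_icat ?reduced_rev//.
  by rewrite rev_rcons.
by rewrite revK; case: (rcons u x) yu => //= z w; rewrite eq_sym.
Qed.

End InfiniteWords.

Section Boundary.
Context {R : realType} {L : finType}.
Implicit Types (x y : L) (w : seq L) (g h p : cox L) (om : nat -> L).
Implicit Types (u v : nat -> cox L).

Local Notation gens := (@gens L).
Local Notation dist := (word_dist R gens).
Local Notation gp := (gromov_product dist).
Local Notation boundary := (boundary R gens).
Implicit Types (xi eta : boundary).

Lemma near2_natP (P : nat -> nat -> Prop) : (\forall i & j \near \oo, P i j) <->
  exists N, forall i j, (N <= i)%N -> (N <= j)%N -> P i j.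
Proof.
split=> [[[A B] [[M _ MA] [N _ NB]] AB]|[N NP]].
  exists (maxn M N) => i j; rewrite !geq_max => /andP[Mi _] /andP[_ Nj].
  by apply: (AB (i, j)); split; [exact: MA|exact: NB].
by exists ([set i | N <= i]%N, [set i | N <= i]%N) => [|[i j] [/NP]]; [split; exists N|exact].
Qed.

Definition converges u om := forall n, exists N, forall i, (N <= i)%N ->
  (n <= size (u i))%N && (take n (u i) == mkseq om n).

Lemma converges_uniq u om om' : converges u om -> converges u om' -> om = om'.
Proof.
move=> uo uo'; apply/funext => n; have [N NP] := uo n.+1; have [N' NP'] := uo' n.+1.
have /andP[_ /eqP E] := NP _ (leq_maxl N N').
have /andP[_ /eqP] := NP' _ (leq_maxr N N'); rewrite E.
by move/mkseq_eqP; exact.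
Qed.

Lemma converges_reduced u om : converges u om -> ireduced om.
Proof.
move=> uo n; have [N /(_ _ (leqnn N)) /andP[_ /eqP E]] := uo n.+2.
have := reduced_take n.+2 (word_reduced (u N)); rewrite E.
move=> /(sortedP (om 0%N)) /(_ n); rewrite size_mkseq !nth_mkseq//; exact.
Qed.

(** Large Gromov products force long common prefixes, so the [n]-th letter of [u
    i] is eventually constant. *)
Lemma asymptotic_self_converges u : asymptotic R gens u u -> exists om, converges u om.
Proof.
move=> uu; have H n : exists N, forall i j, (N <= i)%N -> (N <= j)%N ->
    [&& (n <= size (u i))%N, (n <= size (u j))%N & take n (u i) == take n (u j)].
  have /near2_natP[N NP] := uu 1%g n%:R; exists N => i j Ni Nj.
  by rewrite -(@gp_ge R); exact: NP.
have [N NP] := choice H.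
have /(_ _)/cid/= : forall n, exists x, forall i, (N n.+1 <= i)%N ->
    take n.+1 (u i) = rcons (take n (u i)) x.
  move=> n; have /and3P[+ _ _] := NP n.+1 _ _ (leqnn _) (leqnn _).
  case uE : (word (u (N n.+1))) => [//|z w]; rewrite -uE => sn.
  exists (nth z (u (N n.+1)) n) => i Ni.
  have /and3P[ui _ /eqP E] := NP n.+1 _ _ Ni (leqnn _).
  rewrite (take_nth z)//; congr rcons.
  by rewrite -(nth_take z (ltnSn n)) E nth_take.
move=> H'; pose om n := sval (H' n); exists om => n.
exists (\max_(k < n.+1) N k) => i Ni.
have Nk k : (k <= n)%N -> (N k <= i)%N.
  by move=> kn; apply: leq_trans Ni; exact: (leq_bigmax (Ordinal (kn : k < n.+1)%N)).
have /and3P[-> _ _] := NP n _ _ (Nk _ (leqnn _)) (Nk _ (leqnn _)).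
apply/eqP; elim: n Nk {Ni} => [|n IH] Nk; first by rewrite take0.
rewrite /om (svalP (H' n)) ?Nk// IH ?mkseqS// => k kn; apply: Nk; lia.
Qed.

Lemma converges_asymptotic u v om :
  converges u om -> converges v om -> asymptotic R gens u v.
Proof.
move=> uo vo p M; set n := Num.truncn (`|M| + dist 1%g p).
have nM : M + dist 1%g p <= n.+1%:R.
  have := ler_norm M; have : `|M| + dist 1%g p < n.+1%:R by exact: truncnS_gt.
  lra.
have [N NP] := uo n.+1; have [N' NP'] := vo n.+1.
apply/near2_natP; exists (maxn N N') => i j; rewrite !geq_max.
move=> /andP[/NP /andP[ui /eqP uE] _] /andP[_ /NP' /andP[vj /eqP vE]].
have := @gp_change R _ p (u i) (v j).
have : n.+1%:R <= gp 1%g (u i) (v j) by rewrite gp_ge ui vj uE vE /=.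
lra.
Qed.

Lemma asymptotic_converges u v om :
  converges u om -> asymptotic R gens u v -> converges v om.
Proof.
move=> uo uv n; have [N NP] := uo n.
have /near2_natP[N' NP'] := uv 1%g n%:R; exists (maxn N N') => i; rewrite geq_max.
move=> /andP[Ni N'i]; have := NP' _ _ N'i N'i; rewrite gp_ge => /and3P[_ -> /eqP <-].
by have /andP[_ ->] := NP _ Ni.
Qed.

Lemma boundary_classE u om :
  converges u om -> boundary_class R gens u = [set v | converges v om].
Proof.
move=> uo; apply/seteqP; split=> [v [_ uv]|v vo]; first exact: asymptotic_converges uv.
by split; apply: converges_asymptotic (om) _ _.
Qed.

Lemma exists_iword xi : exists om, sval xi = [set v | converges v om].
Proof.
case: xi => _ /= [u uu ->]; have [om uo] := asymptotic_self_converges uu.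
by exists om; exact: boundary_classE.
Qed.

(** The letters along the geodesic ray of the Cayley tree from [1] to [xi]. This
    map identifies the boundary with the space of infinite reduced words
    ([iword_inj], [iword_surj]), its action with [irmul] and its topology with
    pointwise convergence ([iword_act], [boundary_openP]). *)
Definition iword xi : nat -> L := sval (cid (exists_iword xi)).

Lemma iwordP xi u : sval xi u <-> converges u (iword xi).
Proof. by rewrite {1}(svalP (cid (exists_iword xi))). Qed.

Lemma sval_boundary xi : exists u, sval xi u.
Proof. by case: xi => _ /= [u uu ->]; exists u. Qed.

Lemma iword_reduced xi : ireduced (iword xi).
Proof. by have [u /iwordP/converges_reduced] := sval_boundary xi. Qed.

Lemma iword_inj : injective iword.
Proof.
by move=> xi eta E; apply: sval_inj; apply/funext => u; apply/propext; rewrite !iwordP E.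
Qed.

Lemma iwordE xi u om : sval xi u -> converges u om -> iword xi = om.
Proof. by move=> /iwordP; exact: converges_uniq. Qed.

Lemma mkseq_converges om : ireduced om ->
  converges (fun n => of_word (mkseq om n)) om.
Proof.
move=> r n; exists n => i ni; rewrite of_word_red; last exact: reduced_mkseq.
by rewrite size_mkseq ni take_mkseq//=.
Qed.

Lemma iword_surj om : ireduced om -> exists xi, iword xi = om.
Proof.
move=> r; have uo := mkseq_converges r.
have uu := converges_asymptotic uo uo.
have cls : exists2 u, asymptotic R gens u u &
  boundary_class R gens (fun n => of_word (mkseq om n)) = boundary_class R gens u.
  by exists (fun n => of_word (mkseq om n)).
exists (exist (fun A => exists2 u, asymptotic R gens u u & A = boundary_class R gens u)
  _ cls).
by apply: iwordE uo; split.
Qed.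

Lemma converges_push x u om : converges u om -> converges (fun n => gen x * u n)%g (ipush x om).
Proof.
move=> uo n; have [N NP] := uo n.+1; exists N => i /NP/andP[nw /eqP E].
rewrite word_genM; rewrite mkseqS_l in E.
case uE : (word (u i)) nw E => [//|y w] /= nw [-> E]; rewrite /ipush.
case: eqP => _; first by rewrite E eqxx andbT.
case: n nw E {NP} => // n nw E; rewrite mkseqS_l /= eqseq_cons eqxx /=.
rewrite (leqW (ltnW nw)) /=; apply/eqP; rewrite -[ishift (icons x om)]/om.
case: n nw E => // n nw E; have n2 := leqW (leqnSn n).
by rewrite mkseqS_l /= -(take_takel w n2) E take_mkseq.
Qed.

Lemma converges_mul g u om : converges u om -> converges (fun n => g * u n)%g (irmul g om).
Proof.
move=> uo; rewrite -{1}(of_wordK g); elim: (word g) => [|x w IH] /=.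
  by rewrite /of_word big_nil (_ : (fun n => _) = u)//; apply/funext => n; rewrite mul1g.
rewrite /of_word big_cons (_ : (fun n => _) = (fun n => gen x * (of_word w * u n))%g).
  exact: converges_push.
by apply/funext => n; rewrite mulgA.
Qed.

Lemma iword_act g xi : iword (boundary_act g xi) = irmul g (iword xi).
Proof.
have [u ux] := sval_boundary xi.
by apply: (@iwordE _ (fun n => g * u n)%g); [exists u|exact/converges_mul/iwordP].
Qed.

Lemma boundary_ball_agree xi eta n :
  boundary_ball xi n%:R eta <-> forall i, (i < n)%N -> iword xi i = iword eta i.
Proof.
split=> [[u [v [/iwordP xu /iwordP ev /near2_natP[N NP]]]]|E].
  apply/mkseq_eqP; have [N1 NP1] := xu n; have [N2 NP2] := ev n.
  have le_i : (N <= N + N1 + N2)%N by lia.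
  have /andP[_ /eqP <-] := NP1 (N + N1 + N2)%N ltac:(lia).
  have /andP[_ /eqP <-] := NP2 (N + N1 + N2)%N ltac:(lia).
  by have := NP _ _ le_i le_i; rewrite gp_ge => /and3P[_ _ /eqP].
have [u xu] := sval_boundary xi; have [v ev] := sval_boundary eta.
exists u, v; split=> //; apply/near2_natP.
have [N1 NP1] := (iwordP _ _).1 xu n; have [N2 NP2] := (iwordP _ _).1 ev n.
exists (N1 + N2)%N => i j Ni Nj; rewrite gp_ge.
have /andP[-> /eqP ->] := NP1 i ltac:(lia); have /andP[-> /eqP ->] := NP2 j ltac:(lia).
by apply/eqP/mkseq_eqP.
Qed.

Lemma boundary_openP (U : set boundary) : open U <->
  forall xi, U xi -> exists n, forall eta,
    (forall i, (i < n)%N -> iword xi i = iword eta i) -> U eta.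
Proof.
rewrite -[open U]/(boundary_open U); split=> [oU xi /oU[r rU]|H xi /H[n nU]].
  exists (Num.truncn r).+1 => eta /boundary_ball_agree [u [v [xu ev uv]]].
  apply: rU; exists u, v; split=> //; apply: filterS uv => ij.
  by apply: le_trans; rewrite ltW// truncnS_gt.
by exists n%:R => eta /boundary_ball_agree; exact: nU.
Qed.

End Boundary.

(** * Lines of the Cayley tree *)

Section Lines.
Context {R : realType} {L : finType}.

Local Notation gens := (@gens L).
Local Notation boundary := (boundary R gens).
Local Notation boundary2 := (boundary2 R gens).
Implicit Types (xi eta : boundary) (e : boundary2) (om : nat -> L).
Implicit Types (Q : (nat -> L) -> (nat -> L) -> Prop).

Lemma ends e : exists xi eta, xi <> eta /\ sval e = [set xi; eta].
Proof. by case: e. Qed.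

Lemma ends_neq e xi eta : sval e = [set xi; eta] -> xi <> eta.
Proof.
have [a [b [ab ->]]] := ends e => E xe; apply: ab; rewrite -{}xe setUid in E.
have /= -> : [set xi] a by rewrite -E; left.
by have /= -> : [set xi] b by rewrite -E; right.
Qed.

Lemma set2_eq (T : Type) (a b c d : T) : [set a; b] = [set c; d] ->
  (a = c /\ b = d) \/ (a = d /\ b = c).
Proof.
move=> E.
have [ac|ad] : [set c; d] a by rewrite -E; left.
- have [bc|bd] : [set c; d] b by rewrite -E; right.
  + have [da|db] : [set a; b] d by rewrite E; right.
    * by left; split=> //; rewrite bc da ac.
    * by left.
  + by left.
- have [bc|bd] : [set c; d] b by rewrite -E; right.
  + by right.
  + have [ca|cb] : [set a; b] c by rewrite E; left.
    * by right; split=> //; rewrite bd ca ad.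
    * by right.
Qed.

Definition line xi eta (neq : xi <> eta) : boundary2 :=
  exist _ [set xi; eta] (ex_intro _ xi (ex_intro _ eta (conj neq erefl))).

(** The ends of a line come without an order, so the relation is asked for one
    of the two orders. *)
Definition lines Q : set boundary2 := [set e | exists xi eta,
  sval e = [set xi; eta] /\ Q (iword xi) (iword eta)].

Lemma linesP Q e xi eta : sval e = [set xi; eta] ->
  lines Q e <-> Q (iword xi) (iword eta) \/ Q (iword eta) (iword xi).
Proof.
move=> eE; split=> [[a [b [eE' q]]]|[q|q]].
- by have [[-> ->]|[-> ->]] := set2_eq (etrans (esym eE) eE'); [left|right].
- by exists xi, eta.
- by exists eta, xi; rewrite setUC.
Qed.

(** Relations of this kind define clopen sets of lines. *)
Definition local_rel n Q := forall om1 om1' om2 om2',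
  (forall i, (i < n)%N -> om1 i = om1' i) ->
  (forall i, (i < n)%N -> om2 i = om2' i) -> Q om1 om2 -> Q om1' om2'.

Lemma nbhs_agree xi n :
  nbhs xi [set eta | forall i, (i < n)%N -> iword xi i = iword eta i].
Proof.
apply: open_nbhs_nbhs; split=> //.
apply/boundary_openP => eta E; exists n => zeta E' i ni.
by rewrite E// E'.
Qed.

Lemma nbhs_boundaryP xi (A : set boundary) : nbhs xi A -> exists n, forall eta,
  (forall i, (i < n)%N -> iword xi i = iword eta i) -> A eta.
Proof.
rewrite nbhsE => -[U [/boundary_openP oU /oU[n nU]] UA].
by exists n => eta /nU/UA.
Qed.

Lemma lines_open n Q : local_rel n Q -> open (lines Q).
Proof.
move=> locQ; rewrite -[open _]/(boundary2_open _).
exists [set p | Q (iword p.1) (iword p.2) \/ Q (iword p.2) (iword p.1)].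
  rewrite openE => -[xi eta] /= q.
  exists ([set a | forall i, (i < n)%N -> iword xi i = iword a i],
          [set b | forall i, (i < n)%N -> iword eta i = iword b i]).
    by split; exact: nbhs_agree.
  by move=> [a b] /= [A B]; case: q => q; [left|right]; apply: locQ q.
apply/seteqP; split=> [[xi eta] [e eQ /= eE]|[xi eta] /= [q /= ne]].
  by split; [exact/(linesP _ eE)|exact: ends_neq eE].
by exists (line ne) => //; apply/(@linesP _ _ xi eta).
Qed.

Lemma lines_setC Q : ~` lines Q = lines (fun om om' => ~ Q om om' /\ ~ Q om' om).
Proof.
apply/seteqP; split=> e; have [a [b [_ eE]]] := ends e;
  rewrite /= !(linesP _ eE); tauto.
Qed.

Lemma lines_closed n Q : local_rel n Q -> closed (lines Q).
Proof.
move=> locQ; rewrite -openC lines_setC; apply: (@lines_open n).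
move=> om1 om1' om2 om2' E1 E2 [q q'].
by split=> Q'; [apply: q|apply: q']; apply: locQ Q' => i ni; rewrite ?E1 ?E2.
Qed.

(** The geodesic between two boundary points contains the vertex [1] exactly
    when the rays from [1] towards them part at once. *)
Definition through1 om om' := om 0%N <> om' 0%N.

Lemma through1_local : local_rel 1 through1.
Proof. by move=> om1 om1' om2 om2' E1 E2; rewrite /through1 E1// E2. Qed.

Lemma ultra_fin (T : Type) (F : set_system T) (f : T -> L) :
  UltraFilter F -> exists x, F [set t | f t = x].
Proof.
move=> uF; apply: contrapT => /forallNP H.
have : \forall t \near F, forall x, f t <> x.
  apply: filter_forall => x.
  by have [/H//|] := in_ultra_setVsetC [set t | f t = x] uF.
by case/filter_ex => t /(_ (f t)).
Qed.

(** The boundary points of a line through [1] vary in a space of infinite words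
    over a finite alphabet, and the first letters of the two words stay distinct
    in the limit. *)
Lemma through1_compact : compact (lines through1).
Proof.
rewrite compact_ultra => F uF Fth.
have /choice[p pE] e : exists p : boundary * boundary, sval e = [set p.1; p.2].
  by have [a [b [_ ->]]] := ends e; exists (a, b).
have /choice[om1 om1P] n := @ultra_fin _ F (fun e => iword (p e).1 n) uF.
have /choice[om2 om2P] n := @ultra_fin _ F (fun e => iword (p e).2 n) uF.
have lim_word q om : (forall n, F [set e | iword (q e : boundary) n = om n]) ->
    exists xi, iword xi = om.
  move=> H; apply: iword_surj => n.
  have [e [/= <- <-]] := filter_ex (filterI (H n) (H n.+1)).
  exact: iword_reduced.
have [xi xiE] := lim_word (fun e => (p e).1) om1 om1P.
have [eta etaE] := lim_word (fun e => (p e).2) om2 om2P.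
have th : through1 (iword xi) (iword eta).
  rewrite xiE etaE /through1.
  have [e [/= [<- <-] ]] := filter_ex (filterI (filterI (om1P 0%N) (om2P 0%N)) Fth).
  by move/(linesP _ (pE e)) => [//|] => + /esym.
have ne : xi <> eta by move=> E; apply: th; rewrite E.
have agree q om n : (forall n, F [set e | iword (q e : boundary) n = om n]) ->
    \forall e \near F, forall i, (i < n)%N -> om i = iword (q e) i.
  move=> H; have : \forall e \near F, forall i : 'I_n, om i = iword (q e) i.
    by apply: filter_forall => i; apply: filterS (H i) => e ->.
  by apply: filterS => e E i ni; exact: (E (Ordinal ni)).
exists (line ne); split; first by apply/(@linesP _ _ xi eta) => //; left.
move=> /= A; rewrite nbhsE => -[U [oU Ue] UA]; suff: F U by exact: filterS.
have [V oV UV] := (oU : boundary2_open U).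
have Vp : V (xi, eta).
  suff : (V `&` off_diagonal (S:=gens)) (xi, eta) by case.
  by rewrite -UV; exists (line ne).
move: oV; rewrite openE => /(_ _ Vp) [[A1 A2] /= [nA1 nA2] AV].
have [n1 n1P] := nbhs_boundaryP nA1; have [n2 n2P] := nbhs_boundaryP nA2.
have near1 := agree (fun e => (p e).1) om1 n1 om1P.
have near2 := agree (fun e => (p e).2) om2 n2 om2P.
have FF : Filter F by exact: ultra_proper.
apply: filterS2 near1 near2 => e E1 E2.
have : (V `&` off_diagonal (S:=gens)) (p e).
  split; last by apply: ends_neq (pE e).
  by apply: AV; split=> /=; [apply: n1P; rewrite xiE|apply: n2P; rewrite etaE].
rewrite -UV => -[e' Ue' e'E]; suff -> : e = e' by [].
by apply: sval_inj; rewrite pE e'E.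
Qed.

Lemma lines_sub Q Q' : (forall om om', Q om om' -> Q' om om') -> lines Q `<=` lines Q'.
Proof. by move=> QQ' e [a [b [eE /QQ' q]]]; exists a, b. Qed.

Lemma lines_compact n Q : local_rel n Q -> (forall om om', Q om om' -> through1 om om') ->
  compact (lines Q).
Proof.
move=> locQ Qth; apply: subclosed_compact through1_compact (lines_sub Qth).
exact: lines_closed locQ.
Qed.

Lemma lines_act Q g e : lines Q (boundary2_act g e) <->
  lines (fun om om' => Q (irmul (word g) om) (irmul (word g) om')) e.
Proof.
have [a [b [_ eE]]] := ends e.
have eE' : sval (boundary2_act g e) = [set boundary_act g a; boundary_act g b].
  by rewrite /= eE image_setU !image_set1.
by rewrite (linesP _ eE) (linesP _ eE') !iword_act.
Qed.

End Lines.

(** * Currents and clopen sets of lines *)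

(* Evaluation at an index is continuous on a product indexed by an [eqType]. *)
HB.instance Definition _ (R : realType) (G : groupType) (S : seq G) :=
  gen_eqMixin (Cc R S).

Section CurrentsOfLines.
Context {R : realType} {L : finType}.

Local Notation gens := (@gens L).
Local Notation boundary := (boundary R gens).
Local Notation boundary2 := (boundary2 R gens).
Context {e0 : boundary2}.
Local Notation B2 := (borel_boundary2 e0).
Local Notation current := (current e0).
Implicit Types (xi eta : boundary) (e : boundary2) (om : nat -> L) (mu : current).
Implicit Types (Q P : (nat -> L) -> (nat -> L) -> Prop).

Local Notation lines := (@lines R L).

Lemma open_boundary2_measurable (U : set boundary2) :
  open U -> measurable (U : set B2).
Proof. by move=> oU; exact: (@sub_sigma_algebra _ setT (@open (pboundary2 e0)) _ oU). Qed.

Lemma lines_measurable n Q : local_rel n Q -> measurable (lines Q : set B2).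
Proof. by move=> locQ; exact: (open_boundary2_measurable (lines_open locQ)). Qed.

(** Finitely many neighbourhoods of finite measure cover the compact set. *)
Lemma compact_current_fin mu (K : set boundary2) :
  compact K -> closed K -> (sval mu K < +oo)%E.
Proof.
move=> cK clK; have [lf _] := svalP mu.
have /choice[U UP] e : exists U : set boundary2, open_nbhs e U /\ (sval mu U < +oo)%E.
  by have [U] := lf e; exists U.
have cK' : @compact (pboundary2 e0) K by [].
rewrite compact_cover in cK'.
have [|e _|D _ KD] := cK' boundary2 setT U.
- by move=> e _; have [[]] := UP e.
- by exists e => //; have [[]] := UP e.
have mK : measurable (K : set B2).
  rewrite -(setCK K); apply: measurableC; apply: open_boundary2_measurable.
  by rewrite openC.
have mU e : measurable (U e : set B2).
  by apply: open_boundary2_measurable; have [[]] := UP e.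
have := content_sub_fsum (sval mu) (finite_fset D) (fun e _ => mU e) mK KD.
move=> /le_lt_trans; apply.
rewrite fsbig_finite/=; last exact: finite_fset.
apply: lte_sum_pinfty => e _.
by have [] := UP e.
Qed.

Lemma lines_fin mu n Q : local_rel n Q ->
  (forall om om', Q om om' -> through1 om om') -> sval mu (lines Q) \is a fin_num.
Proof.
move=> locQ Qth; rewrite ge0_fin_numE; last exact: measure_ge0.
by apply: compact_current_fin; [exact: lines_compact locQ Qth|exact: lines_closed locQ].
Qed.

Lemma clopen_indic_continuous (A : set boundary2) : open A -> closed A ->
  continuous (\1_A : boundary2 -> R).
Proof.
move=> oA cA e; have [Ae|Ae] := pselect (A e).
  apply: (@near_cst_continuous boundary2 R 1); apply: filterS (open_nbhs_nbhs (conj oA Ae)).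
  by move=> e' Ae'; rewrite indicE mem_set.
apply: (@near_cst_continuous boundary2 R 0).
apply: (@filterS _ (nbhs e) _ (~` A)); last first.
  by apply: open_nbhs_nbhs; split=> //; rewrite openC.
by move=> e' Ae'; rewrite indicE memNset.
Qed.

(** The indicator function of a compact open set is a continuous function with
    compact support. *)
Lemma current_continuous n Q : local_rel n Q ->
  (forall om om', Q om om' -> through1 om om') ->
  continuous (fun mu => fine (sval mu (lines Q))).
Proof.
move=> locQ Qth.
have oQ := @lines_open R _ _ _ locQ; have cQ := @lines_closed R _ _ _ locQ.
have fP : continuous (\1_(lines Q) : boundary2 -> R) /\
    compact (closure [set e | (\1_(lines Q) : boundary2 -> R) e != 0]).
  split; first exact: clopen_indic_continuous.
  rewrite (_ : [set e | _] = lines Q).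
    by rewrite -(closure_id _).1//; exact: lines_compact locQ Qth.
  apply/seteqP; split=> e /=; rewrite indicE pnatr_eq0 eqb0 negbK; first by rewrite inE.
  by move=> Qe; rewrite mem_set.
pose f : Cc R gens := exist _ _ fP.
rewrite (_ : (fun mu => _) = fun mu => pairing mu f); last first.
  apply/funext => mu; rewrite /pairing /Rintegral integral_indic//= ?setIT//.
  exact: lines_measurable locQ.
move=> mu; apply: (@continuous_comp current {ptws Cc R gens -> R} R
  (@pairing R _ gens e0) (fun g => g f)); first exact: initial_continuous.
exact: (@proj_continuous (Cc R gens) (fun=> R) f).
Qed.

Lemma local_push n Q x : local_rel n Q ->
  local_rel n.+1 (fun om om' => Q (ipush x om) (ipush x om')).
Proof.
have push_agree (om om' : nat -> L) : (forall i, (i < n.+1)%N -> om i = om' i) ->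
    forall i, (i < n)%N -> ipush x om i = ipush x om' i.
  move=> E i ni; rewrite /ipush E//; case: eqP => _; first exact: E.
  by case: i ni => //= i ni; apply: E; lia.
by move=> locQ om1 om1' om2 om2' /push_agree E1 /push_agree E2; exact: locQ.
Qed.

(** Moving the base point along the first letter [x] of the first ray is the
    action of [x], which preserves the measure. The lines satisfying [P] are cut
    into pieces according to [x]; the images of the pieces are disjoint, as [x]
    is found again at the start of the second ray and the asymmetry of [T] tells
    the two rays apart. *)
Lemma current_shift mu n n' P T : local_rel n P -> local_rel n' T ->
  (forall om om', P om om' -> through1 om om') ->
  (forall om om', ireduced om -> P om om' ->
    T (ishift om) (icons (om 0%N) om')) ->
  (forall om om', T om om' -> ~ T om' om) ->
  (sval mu (lines P) <= sval mu (lines T))%E.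
Proof.
move=> locP locT Pth PT Tasym; have [_ inv] := svalP mu.
pose Px x om om' := P om om' /\ om 0%N = x.
pose Tx x om om' := T om om' /\ om' 0%N = x.
have locTx x : local_rel n'.+1 (Tx x).
  move=> om1 om1' om2 om2' E1 E2 [t <-]; split; last by rewrite E2.
  by apply: locT t => i ni; [apply: E1|apply: E2]; exact: ltnW.
have locPx x : local_rel n.+1 (Px x).
  move=> om1 om1' om2 om2' E1 E2 [t <-]; split; last by rewrite E1.
  by apply: locP t => i ni; [apply: E1|apply: E2]; exact: ltnW.
have finL : finite_set [set: L] := finite_finset.
have mTx x := lines_measurable (locTx x).
have mPx x := lines_measurable (locPx x).
have le1 : (sval mu (lines P) <= \sum_(x \in [set: L]) sval mu (lines (Px x)))%E.
  apply: content_sub_fsum => //; first exact: (lines_measurable locP).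
  by move=> e [a [b [eE p]]]; exists (iword a 0%N) => //; exists a, b.
have le2 x : (sval mu (lines (Px x)) <= sval mu (lines (Tx x)))%E.
  rewrite -(inv (gen x) (lines (Tx x)))//; apply: le_measure; rewrite ?inE//.
    rewrite (_ : _ @^-1` _ = lines (fun om om' => Tx x (ipush x om) (ipush x om'))).
      exact: (lines_measurable (local_push (locTx x))).
    by apply/seteqP; split=> e; rewrite /= lines_act.
  move=> e [a [b [eE [p ax]]]]; apply/lines_act; exists a, b; split=> //=.
  rewrite /Tx /ipush -ax eqxx ifN; last by apply/eqP; exact: Pth p.
  by split=> //; apply: PT p; exact: iword_reduced.
apply: le_trans le1 _; apply: (@le_trans _ _ (\sum_(x \in [set: L]) sval mu (lines (Tx x)))%E).
  exact: (lee_fsum finL (fun x _ => le2 x)).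
rewrite -measure_fin_bigcup//.
  apply: le_measure; rewrite ?inE.
  - exact: fin_bigcup_measurable.
  - exact: (lines_measurable locT).
  by move=> e [x _ [a [b [eE [t _]]]]]; exists a, b.
move=> x y _ _ [e [[a [b [eE [t <-]]]] [c [d [eE' [t' <-]]]]]].
have [[_ ->]//|[ad bc]] := set2_eq (etrans (esym eE) eE').
by case: (Tasym _ _ t); rewrite ad bc.
Qed.

End CurrentsOfLines.

(** * The mass of the colour changes *)

Section Crossing.
Context {R : realType} {L : finType} (color : L -> option bool).

Local Notation gens := (@gens L).
Local Notation boundary2 := (boundary2 R gens).
Context {e0 : boundary2}.
Local Notation B2 := (borel_boundary2 e0).
Local Notation current := (current e0).
Implicit Types (om : nat -> L) (mu : current).

Local Notation lines := (@lines R L).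

(** Letters whose colour is [None] are the neutral ones. *)
Definition first_color_lt m b om := exists2 n, (n < m)%N &
  color (om n) = Some b /\ forall i, (i < n)%N -> color (om i) = None.

Definition first_color b om := exists m, first_color_lt m b om.

(** A run of neutral letters may be arbitrarily long, so [crossing] is not
    local; bounding the run makes it so. *)
Definition crossing_lt m om om' := [/\ color (om 0%N) = Some false,
  first_color_lt m true (ishift om) & through1 om om'].

Definition crossing om om' := [/\ color (om 0%N) = Some false,
  first_color true (ishift om) & through1 om om'].

Definition long_run m om om' := [/\ color (om 0%N) = Some false,
  (forall i, (i < m)%N -> color (om i.+1) = None) & through1 om om'].

(** A long run seen from its [j]-th vertex: the second ray goes back to the
    letter of colour [false] at the beginning of the run. *)
Definition run_around j m om om' :=
  [/\ forall i, (i < j)%N -> color (om' i) = None, color (om' j) = Some false,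
      forall i, (i < m)%N -> color (om i) = None & through1 om om'].

Lemma crossing_lt_local m : local_rel m.+1 (crossing_lt m).
Proof.
move=> om1 om1' om2 om2' E1 E2 [c0 [n nm [cn cl]] th]; split.
- by rewrite -E1.
- exists n => //; split=> [|i ni]; rewrite /ishift -E1; [exact: cn|lia|exact: cl|lia].
- by rewrite /through1 -E1// -E2.
Qed.

Lemma long_run_local m : local_rel m.+1 (long_run m).
Proof.
move=> om1 om1' om2 om2' E1 E2 [c0 cl th]; split.
- by rewrite -E1.
- by move=> i im; rewrite -E1 ?cl.
- by rewrite /through1 -E1// -E2.
Qed.

Lemma run_around_local j m : local_rel (j + m).+1 (run_around j m).
Proof.
move=> om1 om1' om2 om2' E1 E2 [c0 cj cl th]; split.
- by move=> i im; rewrite -E2 ?c0//; lia.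
- by rewrite -E2//; lia.
- by move=> i im; rewrite -E1 ?cl//; lia.
- by rewrite /through1 -E1// -E2.
Qed.

Lemma lines_crossingE : lines crossing = \bigcup_m lines (crossing_lt m).
Proof.
apply/seteqP; split=> [e [a [b [eE [c0 [m cl] th]]]]|e [m _ [a [b [eE [c0 cl th]]]]]].
  by exists m => //; exists a, b.
by exists a, b; split=> //; split=> //; exists m.
Qed.

Lemma lines_crossing_measurable : measurable (lines crossing : set B2).
Proof.
rewrite lines_crossingE; apply: bigcupT_measurable => m.
exact: (lines_measurable (@crossing_lt_local m)).
Qed.

Lemma crossing_split m :
  lines crossing `<=` lines (crossing_lt m) `|` lines (long_run m).
Proof.
move=> e [a [b [eE [c0 [k [n nk [cn cl]]] th]]]].
have [nm|mn] := ltnP n m; [left|right]; exists a, b; split=> //.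
  by split=> //; exists n.
by split=> // i im; apply: cl; exact: leq_trans mn.
Qed.

(** If the base point lies in the first half of the run, the beginning of the
    run is on one side only. *)
Lemma run_around_asym j m om om' : (j < m)%N ->
  run_around j m om om' -> ~ run_around j m om' om.
Proof. by move=> jm [_ _ cl _] [_ cj _ _]; rewrite cl in cj. Qed.

Lemma run_around_shift mu j m : (j.+1 < m)%N ->
  (sval mu (lines (run_around j m.+1)) <= sval mu (lines (run_around j.+1 m)))%E.
Proof.
move=> jm; apply: current_shift (@run_around_local j m.+1) (@run_around_local j.+1 m) _ _ _.
- by move=> om om' [].
- move=> om om' r [c0 cj cl th]; split=> //.
  + by case=> [_|i ij] /=; [exact: cl|exact: c0].
  + by move=> i im; exact: cl.
  + by rewrite /through1 /= => E; have := r 0%N; rewrite -[om 1%N]/(ishift om 0%N) E eqxx.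
- by move=> om om'; exact: run_around_asym.
Qed.

Lemma long_run_shift mu m : (0 < m)%N ->
  (sval mu (lines (long_run m)) <= sval mu (lines (run_around 0 m)))%E.
Proof.
move=> m0; apply: current_shift (@long_run_local m) (@run_around_local 0 m) _ _ _.
- by move=> om om' [].
- move=> om om' r [c0 cl th]; split=> //.
  by rewrite /through1 /= => E; have := cl _ m0; rewrite -[om 1%N]/(ishift om 0%N) E c0.
- by move=> om om'; exact: run_around_asym.
Qed.

Lemma long_run_le mu n j : (j < n)%N ->
  (sval mu (lines (long_run n.*2)) <= sval mu (lines (run_around j (n.*2 - j))))%E.
Proof.
elim: j => [|j IH] jn; first by rewrite subn0; apply: long_run_shift; rewrite double_gt0.
apply: le_trans (IH (ltnW jn)) _.
have -> : (n.*2 - j = (n.*2 - j.+1).+1)%N by lia.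
by apply: run_around_shift; lia.
Qed.

(** Seen from the [n] vertices of the first half of its neutral run, the same
    set of lines becomes [n] disjoint sets of lines through [1], as the distance
    to the beginning of the run can be read off from the line. So long runs are
    rare, at a rate controlled by a weak* continuous function of the current. *)
Lemma long_run_bound mu n :
  n%:R * fine (sval mu (lines (long_run n.*2))) <= fine (sval mu (lines through1)).
Proof.
pose B j := lines (run_around j (n.*2 - j)).
have mB j : measurable (B j : set B2).
  exact: (lines_measurable (@run_around_local j (n.*2 - j)%N)).
have finL : sval mu (lines (long_run n.*2)) \is a fin_num.
  by apply: lines_fin (@long_run_local n.*2) _ => om om' [].
have finT : sval mu (lines through1) \is a fin_num.
  by apply: lines_fin through1_local _.
have mT : measurable (lines through1 : set B2) := lines_measurable through1_local.
rewrite -lee_fin EFinM (fineK finT).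
have -> : (n%:R%:E * (fine (sval mu (lines (long_run n.*2))))%:E =
    \sum_(j < n) sval mu (lines (long_run n.*2)))%E.
  move: finL; case: (sval mu _) => //= z _.
  by rewrite sumEFin sumr_const card_ord -EFinM mulr_natl.
apply: (@le_trans _ _ (\sum_(j < n) sval mu (B j))%E).
  by apply: lee_sum => j _; exact: long_run_le.
have mU : measurable (\big[setU/set0]_(j < n) B j : set B2) by exact: bigsetU_measurable.
rewrite -measure_semi_additive_ord_I//; last first.
  move=> i j /= ni nj [e [[a [b [eE [ci cji cli _]]]] [c [d [eE' [cj cjj clj _]]]]]].
  have [[ac bd]|[ad bc]] := set2_eq (etrans (esym eE) eE').
  - apply/eqP; rewrite eqn_leq; subst c d.
    by apply/andP; split; rewrite leqNgt; apply/negP;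
      [move/ci; rewrite cjj|move/cj; rewrite cji].
  - by subst c d; move: cji; rewrite clj//; lia.
apply: le_measure; rewrite ?inE// => e; rewrite -bigcup_mkord => -[j _].
by move=> [a [b [eE [_ _ _ th]]]]; exists a, b.
Qed.

Definition crossing_mass mu : R := fine (sval mu (lines crossing)).

Lemma crossing_mass_bounds mu n : let r := fine (sval mu (lines (crossing_lt n.*2))) in
  r <= crossing_mass mu /\
  n%:R * (crossing_mass mu - r) <= fine (sval mu (lines through1)).
Proof.
move=> r; have finC : sval mu (lines (crossing_lt n.*2)) \is a fin_num.
  by apply: lines_fin (@crossing_lt_local n.*2) _ => om om' [].
have finL : sval mu (lines (long_run n.*2)) \is a fin_num.
  by apply: lines_fin (@long_run_local n.*2) _ => om om' [].
have mC : measurable (lines (crossing_lt n.*2) : set B2).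
  exact: (lines_measurable (@crossing_lt_local n.*2)).
have mL : measurable (lines (long_run n.*2) : set B2).
  exact: (lines_measurable (@long_run_local n.*2)).
have mX : measurable (lines crossing : set B2) := lines_crossing_measurable.
have le_sum : (sval mu (lines crossing) <=
    sval mu (lines (crossing_lt n.*2)) + sval mu (lines (long_run n.*2)))%E.
  apply: le_trans (measureU2 (sval mu) mC mL).
  by apply: le_measure; rewrite ?inE//; [exact: measurableU|exact: crossing_split].
have finX : sval mu (lines crossing) \is a fin_num.
  rewrite ge0_fin_numE ?measure_ge0// (le_lt_trans le_sum)//.
  by rewrite ltey_eq fin_numD finC finL.
split.
  apply: fine_le => //; apply: le_measure; rewrite ?inE//.
  by rewrite lines_crossingE => e ce; exists n.*2.
apply: le_trans (long_run_bound mu n); apply: ler_wpM2l => //.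
by rewrite lerBlDl -fineD//; apply: fine_le => //; rewrite fin_numD finC finL.
Qed.

Lemma crossing_mass_continuous : continuous crossing_mass.
Proof.
move=> mu; apply: (@cvgrPdist_lt R R current (nbhs mu) _ _ _).2 => eps eps0.
pose t (nu : current) : R := fine (sval nu (lines through1)).
have ct : continuous t by apply: current_continuous through1_local _.
(* Near [mu] the mass of the lines through [1] is less than [t mu + 1], so that this
   [n] makes the truncation error smaller than [eps / 4] at [mu] and at [nu]. *)
have [n n0 nP] : exists2 n, 0 < n%:R :> R & 4 * (t mu + 1) < eps * n%:R.
  exists (Num.truncn (4 * (t mu + 1) / eps)).+1; first by rewrite ltr0n.
  by rewrite [eps * _]mulrC -ltr_pdivrMr// truncnS_gt.
pose r (nu : current) : R := fine (sval nu (lines (crossing_lt n.*2))).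
have cr : continuous r.
  by apply: current_continuous (@crossing_lt_local n.*2) _ => om om' [].
have nt := (@cvgrPdist_lt R R current (nbhs mu) _ _ _).1 (ct mu) 1 ltr01.
have e4 : 0 < eps / 4 by lra.
have nr := (@cvgrPdist_lt R R current (nbhs mu) _ _ _).1 (cr mu) _ e4.
near=> nu.
have tnu : `|t mu - t nu| < 1 by near: nu; exact: nt.
have rnu : `|r mu - r nu| < eps / 4 by near: nu; exact: nr.
have small la : t la < t mu + 1 -> crossing_mass la - r la < eps / 4.
  move=> tla; have [_] := crossing_mass_bounds la n; rewrite -/(r la) -/(t la) => b.
  by rewrite -(ltr_pM2l n0); apply: (le_lt_trans b); apply: (lt_trans tla); lra.
have := (crossing_mass_bounds mu n).1; have := (crossing_mass_bounds nu n).1.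
rewrite -/(r mu) -/(r nu).
have : crossing_mass mu - r mu < eps / 4 by apply: small; lra.
have : crossing_mass nu - r nu < eps / 4.
  by apply: small; move: tnu; rewrite ltr_norml => /andP[? ?]; lra.
move: rnu; rewrite !ltr_norml => /andP[? ?] ? ? ? ?; apply/andP; split; lra.
Unshelve. all: by end_near.
Qed.

End Crossing.

(** * Axes of elements of infinite order *)

Section PeriodicWords.
Context {L : finType} (x0 : L).
Implicit Types (x y : L) (u v w : seq L) (om : nat -> L).

(** The word [w] repeated for ever; [x0] is a default value, used for empty [w]
    only. *)
Definition iper w : nat -> L := fun n => nth x0 w (n %% size w).

Lemma icat_uniq w om : w != [::] -> icat w om = om -> om = iper w.
Proof.
move=> w0 E; have sw : (0 < size w)%N by case: (w) w0.
apply/funext => n; have [m] := ubnP n; elim: m n => // m IH n nm.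
rewrite -E (icat_nth x0); case: ltnP => [nw|wn].
  by rewrite /iper modn_small.
by rewrite IH /iper; [rewrite -{2}(subnK wn) modnDr|lia].
Qed.

Lemma icat_iper w : icat w (iper w) = iper w.
Proof.
apply/funext => n; rewrite (icat_nth x0); case: ltnP => nw.
  by rewrite /iper modn_small.
by rewrite /iper -{2}(subnK nw) modnDr.
Qed.

(** Both sides are fixed by prepending [u ++ v]. *)
Lemma iper_catC u v : u ++ v != [::] -> icat u (iper (v ++ u)) = iper (u ++ v).
Proof. by move=> uv; apply: icat_uniq => //; rewrite icat_cat -(icat_cat v) icat_iper. Qed.

Lemma iper0 x w : iper (x :: w) 0%N = x.
Proof. by rewrite /iper mod0n. Qed.

Lemma iper_reduced w : w != [::] -> reduced w -> diverge (rev w) w -> ireduced (iper w).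
Proof.
move=> w0 rw d n; rewrite /iper.
have sw : (0 < size w)%N by case: (w) w0.
have nw := ltn_pmod n sw.
have [lt|ge] := ltnP (n %% size w).+1 (size w).
  have -> : (n.+1 %% size w = (n %% size w).+1)%N.
    by rewrite -addn1 -modnDml addn1 modn_small.
  exact: (sortedP x0 rw).
have E : (n %% size w = (size w).-1)%N by lia.
have -> : (n.+1 %% size w = 0)%N.
  by rewrite -addn1 -modnDml addn1 E prednK// modnn.
rewrite E nth_last; move: d; case/lastP: (w) w0 => // u y _.
by rewrite last_rcons rev_rcons; case: u.
Qed.

Lemma mkseq_iper w n : w != [::] ->
  mkseq (iper w) n = flatten (nseq (n %/ size w) w) ++ take (n %% size w) w.
Proof.
move=> w0; have sw : (0 < size w)%N by case: (w) w0.
have [m] := ubnP n; elim: m n => // m IH n nm.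
have small k : (k <= size w)%N -> mkseq (iper w) k = take k w.
  move=> kw; apply: (@eq_from_nth _ x0); first by rewrite size_mkseq size_takel.
  move=> i; rewrite size_mkseq => ik; rewrite nth_mkseq// nth_take//.
  by rewrite /iper modn_small//; lia.
have [lt|ge] := ltnP n (size w).
  by rewrite divn_small// modn_small//= small// ltnW.
rewrite -(subnK ge) divnDr ?dvdnn// divnn sw addn1 /= modnDr.
rewrite -catA -IH; last by lia.
rewrite addnC /mkseq iotaD map_cat -/(mkseq _ _) small// take_size; congr cat.
rewrite add0n -[X in iota X](addn0 (size w)) iotaDl -map_comp; apply: eq_map => i /=.
by rewrite /iper modnDl.
Qed.

End PeriodicWords.

Section BoundaryAction.
Context {R : realType} {L : finType}.
Implicit Types (x y : L) (u v w : seq L) (g h : cox L) (om : nat -> L).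
Local Notation gens := (@gens L).

Lemma irmul_rmul u v om : ireduced om -> irmul (rmul u v) om = irmul u (irmul v om).
Proof.
move=> r; elim: u => //= x u <-; case: (rmul u v) => //= y w.
by case: eqP => //= ->; rewrite ipushK//; exact: irmul_reduced.
Qed.

Lemma boundary_actM g h (xi : boundary R gens) :
  boundary_act (g * h)%g xi = boundary_act g (boundary_act h xi).
Proof. by apply: iword_inj; rewrite !iword_act wordM irmul_rmul//; exact: iword_reduced. Qed.

Lemma boundary_act1 (xi : boundary R gens) : boundary_act 1%g xi = xi.
Proof. by apply: iword_inj; rewrite iword_act. Qed.

Lemma boundary2_actM g h (e : boundary2 R gens) :
  boundary2_act (g * h)%g e = boundary2_act g (boundary2_act h e).
Proof.
by apply: sval_inj; rewrite /= image_comp; apply: eq_imagel => xi _; exact: boundary_actM.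
Qed.

Lemma boundary2_act1 (e : boundary2 R gens) : boundary2_act 1%g e = e.
Proof.
apply: sval_inj; rewrite /= -[RHS]image_id; apply: eq_imagel => xi _.
exact: boundary_act1.
Qed.

End BoundaryAction.

Section CyclicSubgroup.
Context {G : groupType}.
Implicit Types (x a b c g h : G).
Local Open Scope group_scope.

Lemma cyclic_subgroupP x c :
  cyclic_subgroup x c <-> exists m n, c = x ^+ m * x ^- n.
Proof.
split=> [[n [->|->]]|[m [n ->]]].
- by exists n, 0%N; rewrite expg0 invg1 mulg1.
- by exists 0%N, n; rewrite expg0 mul1g.
- have [nm|/ltnW mn] := leqP n m.
    by exists (m - n)%N; left; rewrite expgnFr.
  by exists (n - m)%N; right; rewrite expgnFr// invgM invgK.
Qed.

Lemma cyclic_subgroup1 x : cyclic_subgroup x 1.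
Proof. by exists 0%N; left. Qed.

Lemma cyclic_subgroupX x n : cyclic_subgroup x (x ^+ n).
Proof. by exists n; left. Qed.

Lemma cyclic_subgroupV x c : cyclic_subgroup x c -> cyclic_subgroup x c^-1.
Proof. by case=> n [->|->]; exists n; [right|left; rewrite invgK]. Qed.

Lemma cyclic_subgroupM x a b :
  cyclic_subgroup x a -> cyclic_subgroup x b -> cyclic_subgroup x (a * b).
Proof.
move=> /cyclic_subgroupP[m [n ->]] /cyclic_subgroupP[p [q ->]].
apply/cyclic_subgroupP; exists (m + p)%N, (q + n)%N.
have cmt : commute (x ^- n) (x ^+ p) by apply/commute_sym/commuteV/commuteX2.
by rewrite !expgnDr invgM -!mulgA; congr (_ * _); rewrite !mulgA cmt.
Qed.

Lemma left_cosetP x g h : left_coset (cyclic_subgroup x) g = left_coset (cyclic_subgroup x) h <->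
  cyclic_subgroup x (g^-1 * h).
Proof.
split=> [E|gh].
  have : left_coset (cyclic_subgroup x) h h.
    by exists 1; [exact: cyclic_subgroup1|rewrite mulg1].
  by rewrite -E => -[c xc <-]; rewrite mulKg.
apply/seteqP; split=> _ [c xc <-].
  exists ((g^-1 * h)^-1 * c); last by rewrite invgM invgK !mulgA mulgV mul1g.
  by apply: cyclic_subgroupM xc; exact: cyclic_subgroupV.
by exists (g^-1 * h * c); [exact: cyclic_subgroupM|rewrite !mulgA mulgV mul1g].
Qed.

End CyclicSubgroup.

(** The vertices of the axis of [z], up to the action of [z], are the prefixes
    of its word. *)
Lemma of_word_iper (L : finType) (x0 : L) (z : cox L) n : word z != [::] ->
  of_word (mkseq (iper x0 z) n) = (z ^+ (n %/ size z) * of_word (take (n %% size z) z))%g.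
Proof.
move=> z0; rewrite mkseq_iper// of_word_cat; congr (_ * _)%g.
elim: (_ %/ _)%N => [|m IH]; first by rewrite /of_word big_nil.
by rewrite expgS /= of_word_cat IH of_wordK.
Qed.

Section Axis.
Context {R : realType} {L : finType} (x0 : L) (h z : cox L).
Hypotheses (z0 : word z != [::]) (dz : diverge (rev z) z).

Local Notation gens := (@gens L).
Local Notation boundary := (boundary R gens).
Local Notation boundary2 := (boundary2 R gens).
Local Notation lines := (@lines R L).
Local Notation iper := (iper x0).
Implicit Types (g : cox L) (om : nat -> L) (xi : boundary) (e : boundary2).

Local Notation x := (h * z * h^-1)%g.

Let rz : reduced z := word_reduced z.
Let rrz : reduced (rev z). Proof. by rewrite reduced_rev. Qed.
Let revz0 : rev z != [::]. Proof. by rewrite -size_eq0 size_rev size_eq0. Qed.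
Let drz : diverge (rev (rev z)) (rev z). Proof. by rewrite revK divergeC. Qed.
Let sz : (0 < size z)%N. Proof. by rewrite lt0n size_eq0. Qed.

Lemma fwd_reduced : ireduced (iper z). Proof. exact: iper_reduced. Qed.
Lemma bwd_reduced : ireduced (iper (rev z)). Proof. exact: iper_reduced. Qed.

Let head_rev : iper (rev z) 0%N != iper z 0%N.
Proof.
by move: dz revz0 z0; case: (rev z) => // a u; case: (word z).
Qed.

Definition fwd_end : boundary := sval (cid (@iword_surj R _ _ fwd_reduced)).
Definition bwd_end : boundary := sval (cid (@iword_surj R _ _ bwd_reduced)).

Lemma iword_fwd : iword fwd_end = iper z.
Proof. exact: svalP (cid (@iword_surj R _ _ fwd_reduced)). Qed.

Lemma iword_bwd : iword bwd_end = iper (rev z).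
Proof. exact: svalP (cid (@iword_surj R _ _ bwd_reduced)). Qed.

Lemma fwd_bwd : fwd_end <> bwd_end.
Proof.
move=> /(congr1 iword); rewrite iword_fwd iword_bwd => E.
by move: head_rev; rewrite E eqxx.
Qed.

(** The axis of [z], which passes through [1], and that of [h z h^-1]. *)
Definition axis0 : boundary2 := line fwd_bwd.
Definition axis : boundary2 := boundary2_act h axis0.

(** If no cancellation occurs in [z om], then [om = z om] begins with [z], and
    so on; otherwise [om] begins with the last letter of [z], no cancellation
    occurs in [z^-1 om], and the same argument applies to [z^-1]. *)
Lemma irmul_fixed om : ireduced om -> irmul z om = om -> om = iper z \/ om = iper (rev z).
Proof.
move=> r E.
have noc (w : seq L) : word z = w \/ rev z = w -> irmul w om = om ->
    (if rev w is y :: _ then y != om 0%N else true) -> om = iper w.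
  move=> wE E' d; apply: icat_uniq; first by case: wE => <-.
  by rewrite -{2}E' irmul_icat//; case: wE => <-.
have [zo|zo] := eqVneq (iper (rev z) 0%N) (om 0%N); last first.
  left; apply: noc => //; first by left.
  by move: zo; case: (rev z) => // y u; rewrite iper0.
right; apply: noc; first by right.
  by rewrite -{1}E -irmul_rmul// -wordV -wordM mulVg.
rewrite revK; move: head_rev; rewrite zo.
by case: (word z) => // y u; rewrite iper0 eq_sym.
Qed.

Lemma irmul_fwd : irmul z (iper z) = iper z.
Proof.
rewrite irmul_icat ?icat_iper//.
by move: head_rev; case: (rev z) => // y u; rewrite iper0.
Qed.

Lemma irmul_bwd : irmul z (iper (rev z)) = iper (rev z).
Proof. by rewrite -{1}(icat_iper x0 (rev z)) -{1}(revK z) irmul_revK. Qed.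

Lemma axis0_fixed : fixed_pair z axis0.
Proof.
apply/seteqP; split=> xi /=.
  by move=> [->|->]; apply: iword_inj; rewrite iword_act ?iword_fwd ?iword_bwd;
    [exact: irmul_fwd|exact: irmul_bwd].
move=> /(congr1 iword); rewrite iword_act => /(irmul_fixed (@iword_reduced _ _ xi)) [E|E];
  [left|right]; apply: iword_inj; by rewrite E ?iword_fwd ?iword_bwd.
Qed.

Lemma axis_fixed : fixed_pair x axis.
Proof.
rewrite /fixed_pair /= -[[set _; _]]/(sval axis0) axis0_fixed.
apply/seteqP; split=> [_ [xi /= E <-]|xi /= E].
  by rewrite -boundary_actM mulgVK boundary_actM E.
exists (boundary_act h^-1%g xi) => /=; last by rewrite -boundary_actM mulgV boundary_act1.
by rewrite -{2}E -!boundary_actM !mulgA mulVg mul1g.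
Qed.

Definition axis_vertex j : cox L := (h * of_word (take j z))%g.

(** Seen from its [j]-th vertex, the axis of [z] reads the [j]-th rotation of
    [z] forwards, and its inverse backwards. *)
Lemma axis_from_vertex Q j : (j <= size z)%N ->
  lines Q (boundary2_act (axis_vertex j)^-1%g axis) <->
  Q (iper (rot j z)) (iper (rev (rot j z))) \/ Q (iper (rev (rot j z))) (iper (rot j z)).
Proof.
move=> jz; rewrite /axis -boundary2_actM /axis_vertex invgM mulgVK -of_word_rev.
rewrite lines_act (@linesP _ _ _ _ fwd_end bwd_end)// iword_fwd iword_bwd.
have -> : word (of_word (rev (take j z))) = rev (take j z).
  by rewrite of_word_red// reduced_rev reduced_take.
set p := take j z; set q := drop j z.
have zE : word z = p ++ q by rewrite cat_take_drop.
have -> : irmul (rev p) (iper z) = iper (rot j z).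
  by rewrite /rot -/p -/q {1}zE -iper_catC -?zE// irmul_revK.
suff -> : irmul (rev p) (iper (rev z)) = iper (rev (rot j z)) by [].
rewrite /rot -/p -/q rev_cat -iper_catC -?rev_cat -?zE//.
  by rewrite irmul_icat ?reduced_rev ?reduced_take// revK;
  move: head_rev; rewrite {2}zE; case: (p) => //= y u; rewrite iper0 eq_sym.
by rewrite -size_eq0 size_rev size_cat addnC -size_cat -zE size_eq0.
Qed.

Lemma axis_act c : cyclic_subgroup x c -> boundary2_act c axis = axis.
Proof.
have axisx : boundary2_act x axis = axis.
  rewrite /axis -!boundary2_actM mulgVK boundary2_actM; congr boundary2_act.
  apply: sval_inj; rewrite /= -[[set _; _]]/(sval axis0) axis0_fixed.
  by apply/seteqP; split=> [_ [xi /= E <-]|xi /= E]; [rewrite E|exists xi].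
have actX n : boundary2_act (x ^+ n)%g axis = axis.
  elim: n => [|n IH]; first by rewrite expg0 boundary2_act1.
  by rewrite expgS boundary2_actM IH axisx.
case=> n [->|->]; first exact: actX.
by rewrite -{1}(actX n) -boundary2_actM mulVg boundary2_act1.
Qed.

Lemma axisX n : (x ^+ n = h * z ^+ n * h^-1)%g.
Proof.
elim: n => [|n IH]; first by rewrite !expg0 mulg1 mulgV.
by rewrite !expgS IH !mulgA mulgVK.
Qed.

Lemma cyclicJ c : cyclic_subgroup z c -> cyclic_subgroup x (h * c * h^-1)%g.
Proof.
by case=> n [->|->]; exists n; [left|right]; rewrite axisX// !invgM invgK mulgA.
Qed.

(** The axis passes only through its own vertices: off them, the rays to its two
    ends begin with the same letter. *)
Lemma axis_prefix k : lines through1 (boundary2_act k^-1%g axis0) ->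
  exists n, word k = mkseq (iper z) n \/ word k = mkseq (iper (rev z)) n.
Proof.
rewrite lines_act (@linesP _ _ _ _ fwd_end bwd_end)// iword_fwd iword_bwd wordV.
move=> th; have {th} : through1 (irmul (rev k) (iper z)) (irmul (rev k) (iper (rev z))).
  by case: th => // + /esym.
have := word_reduced k; case/lastP: (word k) => [|u y] ru th; first by exists 0%N; left.
exists (size u).+1.
have [->|n1] := eqVneq (rcons u y) (mkseq (iper z) (size u).+1); first by left.
have [->|n2] := eqVneq (rcons u y) (mkseq (iper (rev z)) (size u).+1); first by right.
case: th; rewrite !irmul_rev_head//; [exact: bwd_reduced|exact: fwd_reduced].
Qed.

Lemma prefix_coset k n : word k = mkseq (iper z) n \/ word k = mkseq (iper (rev z)) n ->
  exists j, (j < size z)%N /\ exists2 c, cyclic_subgroup z c & k = (c * of_word (take j z))%g.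
Proof.
case=> kE; rewrite -(of_wordK k) kE.
  exists (n %% size z)%N; split; first by rewrite ltn_pmod.
  by exists (z ^+ (n %/ size z))%g; [exact: cyclic_subgroupX|exact: of_word_iper].
rewrite (@of_word_iper _ x0 z^-1%g)// wordV size_rev.
set q := (n %/ size z)%N; set r := (n %% size z)%N.
have rz' : (r < size z)%N by rewrite ltn_pmod.
have [r0|r0] := posnP r.
  exists 0%N; split=> //; exists (z^-1 ^+ q)%g; last by rewrite r0 !take0.
  by rewrite expVgn; exists q; right.
exists (size z - r)%N; split; first by lia.
exists (z^-1 ^+ q * z^-1)%g.
  by rewrite -expgSr expVgn; exists q.+1; right.
rewrite take_rev of_word_rev -mulgA; congr (_ * _)%g.
apply: (mulgI z); rewrite mulVKg; set t := of_word (take _ _); set d := of_word _.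
have -> : z = (t * d)%g by rewrite -of_word_cat cat_take_drop of_wordK.
by rewrite mulgK.
Qed.

(** The vertices of the axis form the orbits of those with index less than [size
    z]. *)
Lemma axis_coset g : lines through1 (boundary2_act g axis) -> exists2 j, (j < size z)%N &
  left_coset (cyclic_subgroup x) g = left_coset (cyclic_subgroup x) (axis_vertex j)^-1%g.
Proof.
rewrite /axis -boundary2_actM -{1}(invgK (g * h)%g) => /axis_prefix[n /prefix_coset].
move=> [j [jz [c zc kE]]]; exists j => //; apply/left_cosetP.
have -> : (g^-1 * (axis_vertex j)^-1 = h * c * h^-1)%g; last exact: cyclicJ.
have -> : (g^-1 = h * (g * h)^-1)%g by rewrite invgM mulVKg.
by rewrite kE /axis_vertex invgM !mulgA mulgK.
Qed.

Lemma size_of_word_iper n : size (of_word (mkseq (iper z) n)) = n.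
Proof.
by rewrite of_word_red ?size_mkseq//; apply: reduced_mkseq; exact: fwd_reduced.
Qed.

(** A power of [z] moves the vertices of its axis by a multiple of [size z]. *)
Lemma axis_coset_inj i j : (i < size z)%N -> (j < size z)%N ->
  left_coset (cyclic_subgroup x) (axis_vertex i)^-1%g =
  left_coset (cyclic_subgroup x) (axis_vertex j)^-1%g -> i = j.
Proof.
have take_iper k : (k < size z)%N -> of_word (take k z) = of_word (mkseq (iper z) k).
  by move=> kz; rewrite of_word_iper// divn_small// modn_small// expg0 mul1g.
have uniq k l n : (k < size z)%N -> (l < size z)%N ->
    of_word (take k z) = (z ^+ n * of_word (take l z))%g -> k = l.
  move=> kz lz.
  have -> : (z ^+ n * of_word (take l z))%g = of_word (mkseq (iper z) (n * size z + l)).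
    by rewrite of_word_iper// divnMDl// modnMDl divn_small// modn_small// addn0.
  rewrite take_iper// => /(congr1 (fun g => size g)); rewrite !size_of_word_iper.
  by case: n => [|n]; rewrite ?mulSn; lia.
move=> iz jz /left_cosetP[n E].
have vE : ((axis_vertex i)^-1^-1 * (axis_vertex j)^-1 =
    h * (of_word (take i z) * (of_word (take j z))^-1) * h^-1)%g.
  by rewrite invgK /axis_vertex invgM !mulgA.
have eqz : (of_word (take i z) * (of_word (take j z))^-1 = z ^+ n)%g \/
           (of_word (take i z) * (of_word (take j z))^-1 = z ^- n)%g.
  have xV : (x ^- n = h * z ^- n * h^-1)%g by rewrite axisX !invgM invgK mulgA.
  by move: E; rewrite vE xV axisX => -[/mulIg/mulgI|/mulIg/mulgI]; [left|right].
case: eqz => Ez.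
  by apply: (uniq _ _ n) => //; rewrite -Ez mulgVK.
apply/esym; apply: (uniq _ _ n) => //.
by rewrite -(invgK (z ^+ n)%g) -Ez invgM invgK mulgVK.
Qed.

End Axis.

(** * Rational currents *)

Section OrbitCount.
Context d (T : measurableType d) (R : realType) (I : choiceType).
Variables (D : set I) (phi : I -> T).

Definition orbit_count (A : set T) : \bar R := \esum_(i in D `&` phi @^-1` A) 1%E.

Let orbit_count0 : orbit_count set0 = 0%E.
Proof. by rewrite /orbit_count preimage_set0 setI0 esum_set0. Qed.

Let orbit_count_ge0 A : (0 <= orbit_count A)%E.
Proof. exact: esum_ge0. Qed.

Let orbit_count_sigma_additive : semi_sigma_additive orbit_count.
Proof.
move=> F mF tF _; rewrite /orbit_count preimage_bigcup setI_bigcupr.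
rewrite nneseries_sum_bigcup//; last first.
  move=> i j _ _ [a [[_ Fi] [_ Fj]]]; apply: tF => //.
  by exists (phi a).
by apply: is_cvg_nneseries => n _ _; exact: esum_ge0.
Qed.

HB.instance Definition _ := isMeasure.Build _ _ _ orbit_count
  orbit_count0 orbit_count_ge0 orbit_count_sigma_additive.

Lemma orbit_count_dirac A : orbit_count A = \esum_(i in D) \d_(phi i) A.
Proof.
rewrite /orbit_count esum_mkcondr; apply: eq_esum => i _; rewrite diracE.
by rewrite (_ : (i \in phi @^-1` A) = (phi i \in A)); [case: ifP|].
Qed.

Lemma orbit_count_fin (A : set T) n (f : 'I_n -> I) : injective f -> (forall j, D (f j)) ->
  (forall i, D i -> A (phi i) -> exists j, i = f j) ->
  orbit_count A = (\sum_(j < n) (phi (f j) \in A)%:R)%:E.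
Proof.
move=> finj fD fA; rewrite /orbit_count.
have -> : D `&` phi @^-1` A = f @` [set j | A (phi (f j))].
  apply/seteqP; split=> [i [Di Ai]|_ [j Aj <-]]; last by split=> //; exact: fD.
  by have [j ij] := fA i Di Ai; exists j; rewrite /= -ij.
rewrite esum_image; last by move=> i j _ _; exact: finj.
rewrite esum_mkcond esum_fset; [|exact: finite_finset|by move=> i _; case: ifP].
rewrite -sumEFin (_ : setT = [set` index_enum 'I_n]); last first.
  by apply/seteqP; split=> j _ /=; rewrite ?mem_index_enum.
rewrite -fsbig_seq ?index_enum_uniq//; apply: eq_bigr => j _.
by rewrite (_ : (j \in [set j | A (phi (f j))]) = (phi (f j) \in A)); [case: ifP|].
Qed.

End OrbitCount.

Section RationalCurrent.
Context {R : realType} {L : finType} {e0 : boundary2 R (@gens L)}.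
Context (x0 : L) (h z : cox L).
Hypotheses (z0 : word z != [::]) (dz : diverge (rev z) z).

Local Notation gens := (@gens L).
Local Notation boundary2 := (boundary2 R gens).
Local Notation B2 := (borel_boundary2 e0).
Local Notation lines := (@lines R L).
Local Notation iper := (iper x0).
Implicit Types (g : cox L) (om : nat -> L) (e : boundary2) (A : set B2).
Implicit Types (Q : (nat -> L) -> (nat -> L) -> Prop).

Local Notation x := (h * z * h^-1)%g.
Local Notation axis := (@axis R L x0 h z z0 dz).
Local Notation coset := (left_coset (cyclic_subgroup x)).
Local Notation vertex := (axis_vertex h z).

Definition coset_axis (C : set (cox L)) : B2 := boundary2_act (xget 1%g C) axis.

Lemma coset_axisE g : coset_axis (coset g) = boundary2_act g axis.
Proof.
have [c xc cE] : coset g (xget 1%g (coset g)).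
  by apply: (xgetPex 1%g); exists g; exists 1%g; [exact: cyclic_subgroup1|rewrite mulg1].
by rewrite /coset_axis -cE boundary2_actM axis_act.
Qed.

Local Notation count := (orbit_count R (range coset) coset_axis).

(** A translate [g axis] passes through [1] when [g^-1] is a vertex of the axis,
    and the coset of [g] determines this vertex up to the period: the cosets
    which count correspond to the vertices of one period. *)
Lemma count_lines Q : (forall om om', Q om om' -> through1 om om') ->
  count (lines Q) = (\sum_(j < size z)
    (`[< Q (iper (rot j z)) (iper (rev (rot j z))) \/
         Q (iper (rev (rot j z))) (iper (rot j z)) >])%:R)%:E.
Proof.
move=> Qth.
rewrite (@orbit_count_fin _ B2 R _ (range coset) coset_axis _ _
  (fun j : 'I_(size z) => coset (vertex j)^-1%g)).
- congr (_%:E); apply: eq_bigr => j _; congr (nat_of_bool _)%:R.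
  rewrite coset_axisE; apply/idP/asboolP; rewrite inE.
    by move/(@axis_from_vertex R L x0 h z z0 dz Q j (ltnW (ltn_ord j))).
  by move=> q; apply/(@axis_from_vertex R L x0 h z z0 dz Q j (ltnW (ltn_ord j))).
- by move=> i j /axis_coset_inj E; apply: val_inj; apply: E.
- by move=> j; eexists.
- move=> _ [g _ <-]; rewrite coset_axisE => /(lines_sub Qth)/axis_coset[j jz E].
  by exists (Ordinal jz).
Qed.

(** Left multiplication by [g] permutes the cosets. *)
Lemma count_invariant g A : count (@boundary2_act R _ gens g @^-1` A) = count A.
Proof.
pose shift (C : set (cox L)) := [set (g * a)%g | a in C].
have shiftE a : shift (coset a) = coset (g * a)%g.
  rewrite /shift /left_coset image_comp; apply: eq_imagel => c _ /=.
  by rewrite mulgA.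
apply/esym; apply: (@reindex_esum R _ _ _ _ shift); split.
- move=> _ [[a _ <-] /=]; rewrite shiftE !coset_axisE boundary2_actM.
  by split=> //; exists (g * a)%g.
- move=> _ _ /set_mem[[a _ <-] _] /set_mem[[b _ <-] _]; rewrite !shiftE.
  move=> /left_cosetP E; apply/left_cosetP; move: E.
  by rewrite invgM mulgA mulgVK.
- move=> _ [[a _ <-] Aa]; exists (coset (g^-1 * a)%g).
    split; first by exists (g^-1 * a)%g.
    by move: Aa; rewrite /= !coset_axisE -boundary2_actM mulVKg.
  by rewrite shiftE mulVKg.
Qed.

Lemma local_irmul n w Q : local_rel n Q ->
  local_rel (n + size w) (fun om om' => Q (irmul w om) (irmul w om')).
Proof.
elim: w n Q => [|y w IH] n Q locQ; first by rewrite addn0.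
by rewrite addnS -addSn; exact: IH (local_push (x := y) locQ).
Qed.

(** A line passes through the point where the rays from [1] to its two ends
    part. *)
Lemma line_through_vertex e : exists g, lines through1 (boundary2_act g e).
Proof.
have [a [b [ab eE]]] := ends e.
have [n nE] : exists n, iword a n != iword b n.
  apply: contrapT => /forallNP H; apply: ab; apply: iword_inj; apply/funext => n.
  by apply/eqP; apply: contrapT => /negP; exact: H.
have [{nE}n nE min] := ex_minnP (ex_intro (fun n => iword a n != iword b n) n nE).
have icat_mkseq (om : nat -> L) : icat (mkseq om n) (fun i => om (n + i)%N) = om.
  apply/funext => i; rewrite (icat_nth (om 0%N)) size_mkseq; case: ltnP => ni.
    by rewrite nth_mkseq.
  by rewrite subnKC.
have E : mkseq (iword a) n = mkseq (iword b) n.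
  apply/mkseq_eqP => i; rewrite ltnNge => ni; apply/eqP; apply: contraNT ni.
  exact: min.
exists (of_word (mkseq (iword a) n))^-1%g.
apply/lines_act/(linesP _ eE); left; rewrite wordV of_word_red /through1; last first.
  by apply: reduced_mkseq; exact: iword_reduced.
rewrite -{2}(icat_mkseq (iword a)) irmul_revK {1}E -{2}(icat_mkseq (iword b)) irmul_revK.
by rewrite addn0; exact/eqP.
Qed.

(** Some translate of the line passes through [1], and only finitely many
    translates of the axis do. *)
Lemma count_locally_finite e : exists2 U : set boundary2, open_nbhs e U & (count U < +oo)%E.
Proof.
have [g ge] := line_through_vertex e.
exists (boundary2_act g @^-1` lines through1).
  split=> //; rewrite (_ : _ @^-1` _ =
      lines (fun om om' => through1 (irmul (word g) om) (irmul (word g) om'))).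
    exact: (lines_open (local_irmul (w := word g) through1_local)).
  by apply/seteqP; split=> e' /=; rewrite lines_act.
by rewrite count_invariant count_lines// ltry.
Qed.

Variables (la : R) (la0 : 0 < la).

Definition rational_mass : {measure set B2 -> \bar R} := mscale (NngNum (ltW la0)) count.

Lemma rational_mass_current : locally_finite rational_mass /\ invariant_measure rational_mass.
Proof.
split=> [e|g A mA].
  have [U nU cU] := count_locally_finite e; exists U => //.
  by rewrite /= /mscale lte_mul_pinfty.
by rewrite /= /mscale; congr (_ * _)%E; exact: count_invariant.
Qed.

Definition rational_current : current e0 := exist _ _ rational_mass_current.

Lemma rational_currentP : scaled_rational_current x la rational_current.
Proof.
exists axis; first exact: axis_fixed.
by move=> A mA; rewrite /= /mscale; congr (_ * _)%E; exact: orbit_count_dirac.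
Qed.

Lemma crossing_mass_rational (color : L -> option bool) :
  crossing_mass color rational_current = la * (\sum_(j < size z)
    (`[< crossing color (iper (rot j z)) (iper (rev (rot j z))) \/
         crossing color (iper (rev (rot j z))) (iper (rot j z)) >])%:R).
Proof.
transitivity (fine (la%:E * count (lines (crossing color)))); first by [].
by rewrite count_lines// => om om' [].
Qed.

End RationalCurrent.

(** * Counting colour changes of a cyclic word *)

Section PathLength.
Context {R : realDomainType}.
Implicit Types (s t q : R) (l : seq R).

Fixpoint pathlen s l t := if l is q :: l' then `|s - q| + pathlen q l' t else `|s - t|.

Lemma pathlen_cat s l1 q l2 t :
  pathlen s (l1 ++ q :: l2) t = pathlen s l1 q + pathlen q l2 t.
Proof. by elim: l1 s => //= p l1 IH s; rewrite IH addrA. Qed.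

Lemma pathlen_rev s l t : pathlen s (rev l) t = pathlen t l s.
Proof.
elim: l s t => [|q l IH] s t /=; first exact: distrC.
by rewrite rev_cons -cats1 pathlen_cat IH /= addrC distrC.
Qed.

Lemma pathlen_last s l1 l2 t :
  pathlen s (l1 ++ l2) t = pathlen s l1 (last s l1) + pathlen (last s l1) l2 t.
Proof.
elim: l1 s => [|q l1 IH] s /=; first by rewrite subrr normr0 add0r.
by rewrite IH addrA.
Qed.

Lemma pathlen_ge0 s l t : 0 <= pathlen s l t.
Proof. by elim: l s => //= q l IH s; rewrite addr_ge0. Qed.

Lemma pathlen_triangle s l1 q l2 t :
  pathlen s (l1 ++ l2) t <= pathlen s l1 q + pathlen q l2 t.
Proof.
elim: l1 s => [|p l1 IH] s /=; last by rewrite -addrA lerD2l.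
case: l2 => [|p l2] /=; first exact: ler_distD.
by rewrite addrA lerD2r ler_distD.
Qed.

Lemma pathlen_power s l n : last s l = s ->
  pathlen s (flatten (nseq n l)) s = n%:R * pathlen s l s.
Proof.
move=> ls; elim: n => [|n IH] /=; first by rewrite subrr normr0 mul0r.
by rewrite pathlen_last ls IH -natr1 mulrDl mul1r addrC.
Qed.

End PathLength.

Section CyclicCount.
Context {R : realType} {L : finType} (color : L -> option bool) (x0 : L).
Implicit Types (y : L) (w z p q : seq L) (om : nat -> L) (b c : bool).

Local Notation iper := (iper x0).

Definition colors w : seq bool := pmap color w.

Definition next_color b om : bool := `[< first_color color b om >].

Lemma next_color_cons b y om :
  next_color b (icons y om) = if color y is Some c then c == b else next_color b om.
Proof.
rewrite /next_color; case cy: (color y) => [c|].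
  apply/asboolP/eqP => [[m [[|n] _ [/= cn cl]]]|<-]; last by exists 1%N, 0%N.
    by move: cn; rewrite cy => -[].
  by have := cl 0%N isT; rewrite /= cy.
apply/asboolP/asboolP => [[m [[|n] _ [/= cn cl]]]|[m [n _ [cn cl]]]].
- by rewrite cy in cn.
- by exists n.+1, n => //; split=> // i ni; exact: (cl i.+1).
- by exists n.+2, n.+1 => //; split=> // -[|i] //= ni; exact: cl.
Qed.

Lemma next_color_cat b w om :
  next_color b (icat w om) = if colors w is c :: _ then c == b else next_color b om.
Proof.
by elim: w => //= y w IH; rewrite next_color_cons /colors /=; case: (color y).
Qed.

Lemma next_color_iper b z c0 : colors z != [::] ->
  next_color b (iper z) = (head c0 (colors z) == b).
Proof. by move=> cz; rewrite -icat_iper next_color_cat; case: (colors z) cz. Qed.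

Lemma colors_rev w : colors (rev w) = rev (colors w).
Proof.
rewrite /colors; elim: w => //= y w IH; rewrite rev_cons -cats1 pmap_cat IH /=.
by case: (color y) => [c|] /=; rewrite ?rev_cons ?cats1 ?cats0.
Qed.

Lemma rot_icons z j : (j < size z)%N ->
  iper (rot j z) = icons (nth x0 z j) (iper (rot j.+1 z)) /\
  iper (rev (rot j.+1 z)) = icons (nth x0 z j) (iper (rev (rot j z))).
Proof.
move=> jz; rewrite /rot (drop_nth x0 jz) (take_nth x0 jz).
set y := nth _ _ _; set q := drop _ _; set p := take _ _; split.
  by rewrite -cats1 catA -[icons y _]/(icat [:: y] _) iper_catC.
rewrite -cats1 catA rev_cat cat_cons [rev (y :: (q ++ p))]rev_cons -(cats1 (rev _)).
by rewrite -[icons y _]/(icat [:: y] _) iper_catC.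
Qed.

Lemma next_color_back b z j : colors z != [::] -> (j <= size z)%N ->
  next_color b (iper (rev (rot j z))) =
  (last (last false (colors z)) (colors (take j z)) == b).
Proof.
move=> cz; elim: j => [_|j IH jz].
  rewrite rot0 take0 (next_color_iper _ false) colors_rev; last first.
    by rewrite -size_eq0 size_rev size_eq0.
  by case/lastP: (colors z) => //= u c; rewrite rev_rcons last_rcons.
rewrite (rot_icons jz).2 next_color_cons IH ?(ltnW jz)// (take_nth x0 jz).
rewrite /colors -cats1 pmap_cat last_cat /=.
by case: (color _).
Qed.

(** The end of the fundamental edge fixed by the letters of colour [b]. *)
Definition color_pos b : R := b%:R.

(** The number of colour changes of the cyclic word [z]: starting at the last
    colour makes the path through the colours of [z] a closed one. *)
Definition cyclic_length z : R := let s := color_pos (last false (colors z)) in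
  pathlen s (map color_pos (colors z)) s.

Lemma pathlen_sum c w : pathlen (color_pos c) (map color_pos (colors w))
    (color_pos (last c (colors w))) =
  \sum_(j < size w) `|color_pos (last c (colors (take j w))) -
                      color_pos (last c (colors (take j.+1 w)))|.
Proof.
elim: w c => [|y w IH] c; first by rewrite big_ord0 /= subrr normr0.
rewrite big_ord_recl /= take0 /colors /=.
case cy: (color y) => [d|] /=; rewrite -/(colors w) IH.
  by [].

by rewrite subrr normr0 add0r.
Qed.

Hypothesis color_inj : forall y y' b, color y = Some b -> color y' = Some b -> y = y'.

(** The two rays of a line through [1] start with different letters, so at most
    one of them starts with the letter of colour [false]. *)
Lemma crossing_countE om om' : through1 om om' ->
  (`[< crossing color om om' \/ crossing color om' om >] : nat) =
  (((color (om 0%N) == Some false) && next_color true (ishift om)) +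
   ((color (om' 0%N) == Some false) && next_color true (ishift om')))%N.
Proof.
move=> th; set c1 := _ && _; set c2 := _ && _.
have P1 : crossing color om om' <-> c1.
  split=> [[E ? _]|/andP[/eqP ? /asboolP ?]]; last by split.
  by rewrite /c1 E eqxx; exact/asboolP.
have P2 : crossing color om' om <-> c2.
  split=> [[E ? _]|/andP[/eqP ? /asboolP ?]]; last by split=> // E; apply: th.
  by rewrite /c2 E eqxx; exact/asboolP.
have -> : `[< crossing color om om' \/ crossing color om' om >] = c1 || c2.
  by apply/asboolP/orP; rewrite P1 P2.
have : ~~ (c1 && c2).
  apply/negP => /andP[/andP[/eqP E1 _] /andP[/eqP E2 _]].
  exact: th (color_inj E1 E2).
by case: (c1); case: (c2).
Qed.

Lemma rot_through1 z j : reduced (z ++ z) -> (j < size z)%N ->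
  through1 (iper (rot j z)) (iper (rev (rot j z))).
Proof.
rewrite /rot; set q := drop j z; set p := take j z => r jz.
have q0 : q != [::] by rewrite -size_eq0 size_drop subn_eq0 -ltnNge.
have : diverge (rev (q ++ p)) q.
  move: r; rewrite -(cat_take_drop j z) -/p -/q -catA (catA q) !reduced_cat.
  by case/and3P => _ /and3P[_ _].
rewrite /through1; have : rev (q ++ p) != [::].
  by rewrite -size_eq0 size_rev size_cat addn_eq0 size_eq0 (negPf q0).
case: (rev (q ++ p)) => // a u _; case: (q) q0 => // b v _ /= ab.
by rewrite !iper0 => E; rewrite E eqxx in ab.
Qed.

(** The path length counts every colour change at its end. The crossings count
    the changes from [true] to [false] at their end, read backwards, but those
    from [false] to [true] at their beginning, read forwards. Over one period
    this makes no difference: up to [j], the number of beginnings minus the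
    number of ends is [gap j - gap 0], where [gap] tells whether a position is
    in a gap from [false] to [true], and [gap (size z) = gap 0]. *)
Lemma cyclic_length_crossing z : reduced (z ++ z) ->
  \sum_(j < size z)
    (`[< crossing color (iper (rot j z)) (iper (rev (rot j z))) \/
         crossing color (iper (rev (rot j z))) (iper (rot j z)) >])%:R =
  cyclic_length z.
Proof.
move=> rzz.
pose fw j := iper (rot j z); pose bw j := iper (rev (rot j z)).
pose c1 j := (color (fw j 0%N) == Some false) && next_color true (ishift (fw j)).
pose c2 j := (color (bw j 0%N) == Some false) && next_color true (ishift (bw j)).
have -> : \sum_(j < size z) (`[< crossing color (fw j) (bw j) \/
    crossing color (bw j) (fw j) >])%:R = \sum_(j < size z) ((c1 j)%:R + (c2 j.+1)%:R) :> R.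
  rewrite big_split /= -[X in _ + X](addrNK (\sum_(j < size z) (c2 j)%:R)) -sumrB.
  rewrite -(big_mkord xpredT (fun j => (c2 j.+1)%:R - (c2 j)%:R)) telescope_sumr//.
  rewrite /c2 /bw rot_size rot0 subrr add0r -big_split /=; apply: eq_bigr => j _.
  by rewrite -natrD -crossing_countE//; exact: rot_through1.
have c1E j : (j < size z)%N ->
    c1 j = (color (nth x0 z j) == Some false) && next_color true (fw j.+1).
  by move=> jz; rewrite /c1 /fw (rot_icons jz).1.
have c2E j : (j < size z)%N ->
    c2 j.+1 = (color (nth x0 z j) == Some false) && next_color true (bw j).
  by move=> jz; rewrite /c2 /bw (rot_icons jz).2.
have [cz|cz] := eqVneq (colors z) [::].
  rewrite /cyclic_length cz /= subrr normr0 big1// => j _.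
  have nc : color (nth x0 z j) = None.
    case cE: (color _) => [c|//]; suff : c \in colors z by rewrite cz.
    by rewrite mem_pmap -cE map_f// mem_nth.
  by rewrite c1E// c2E// nc addr0.
pose c := last false (colors z); pose st j := last c (colors (take j z)).
have lastc : last c (colors z) = c.
  by rewrite /c; case/lastP: (colors z) => // u d; rewrite !last_rcons.
have stS j : (j < size z)%N -> st j.+1 = if color (nth x0 z j) is Some d then d else st j.
  move=> jz; rewrite /st (take_nth x0 jz) /colors -cats1 pmap_cat last_cat /=.
  by case: (color _).
have back b j : (j <= size z)%N -> next_color b (bw j) = (st j == b).
  exact: next_color_back.
pose gap j := ~~ st j && next_color true (fw j).
have -> : cyclic_length z = \sum_(j < size z)
    (`|color_pos (st j) - color_pos (st j.+1)| + ((gap j.+1)%:R - (gap j)%:R)).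
  rewrite big_split /= -(big_mkord xpredT (fun j => (gap j.+1)%:R - (gap j)%:R)).
  rewrite telescope_sumr// /gap /fw rot_size rot0 /st take_size take0 lastc subrr addr0.
  by rewrite /cyclic_length -/c -{2}lastc pathlen_sum.
apply: eq_bigr => j _; have jz := ltn_ord j.
rewrite c1E// c2E// /gap back; last exact: ltnW.
rewrite stS// /fw (rot_icons jz).1 next_color_cons.
case: (color _) => [[]|] /=; case: (st j); case: (next_color _ _);
  rewrite /color_pos /= ?mulr1n ?mulr0n ?subr0 ?sub0r ?addr0 ?subrr ?normrN ?normr1 ?normr0 //; lra.
Qed.

End CyclicCount.

(** * The tree *)

Section FourPoints.
Context {R : realType}.
Implicit Types (s t c k : R) (P M : seq R).

(** The two largest of the three numbers are equal. The four-point condition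
    says this about the sums of distances for the three ways to split four
    points into two pairs; in this form it is symmetric in the four points. *)
Definition two_largest (a b c : R) :=
  [/\ a <= Num.max b c, b <= Num.max a c & c <= Num.max a b].

Lemma line_four_points (c1 c2 c3 c4 : R) : `|c1 - c2| + `|c3 - c4| <=
  Num.max (`|c1 - c3| + `|c2 - c4|) (`|c1 - c4| + `|c2 - c3|).
Proof.
rewrite le_max; apply/orP.
have [A|A] := lerP (`|c1 - c2| + `|c3 - c4|) (`|c1 - c3| + `|c2 - c4|); first by left.
right; move: A.
case: (ger0P (c1 - c2)) => ?; case: (ger0P (c3 - c4)) => ?;
case: (ger0P (c1 - c3)) => ?; case: (ger0P (c2 - c4)) => ?;
case: (ger0P (c1 - c4)) => ?; case: (ger0P (c2 - c3)) => ?; lra.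
Qed.

(** Seen from outside, an arm [P] ending at [s] consists of its first point [c]
    and the length [k] beyond. *)
Lemma arm P s : exists c k,
  (forall t M, pathlen t (M ++ P) s = pathlen t M c + k) /\
  (forall t M, pathlen s (rev P ++ M) t = k + pathlen c M t).
Proof.
case: P => [|c P].
  by exists s, 0; split=> t M; rewrite ?cats0 ?addr0 ?add0r.
exists c, (pathlen c P s); split=> t M; first exact: pathlen_cat.
by rewrite rev_cons cat_rcons pathlen_cat pathlen_rev.
Qed.

(** Two arms on either side of a path through the points of [M]. If [M] is not
    empty, every path from one side to the other passes through its first and
    its last point; if it is empty, the first points of the arms are four points
    of the line. *)
Lemma four_arms P1 s1 P2 s2 P3 s3 P4 s4 M : two_largest
  (pathlen s1 (rev P1 ++ P2) s2 + pathlen s3 (rev P3 ++ P4) s4)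
  (pathlen s1 (rev P1 ++ M ++ P3) s3 + pathlen s2 (rev P2 ++ M ++ P4) s4)
  (pathlen s1 (rev P1 ++ M ++ P4) s4 + pathlen s2 (rev P2 ++ M ++ P3) s3).
Proof.
have [c1 [k1 [ro1 ri1]]] := arm P1 s1; have [c2 [k2 [ro2 ri2]]] := arm P2 s2.
have [c3 [k3 [ro3 ri3]]] := arm P3 s3; have [c4 [k4 [ro4 ri4]]] := arm P4 s4.
rewrite !ri1 !ri2 !ri3 !ro3 !ro4 -[P2]cat0s -[P4]cat0s !ro2 !ro4 /=.
case: M => [|q M] /=.
  have := line_four_points c1 c2 c3 c4; have := line_four_points c1 c3 c2 c4.
  have := line_four_points c1 c4 c2 c3; rewrite !(distrC c4 c2) !(distrC c3 c2) !(distrC c4 c3).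
  rewrite /two_largest !le_max => /orP A /orP B /orP C.
  split; apply/orP.
  - by case: C => ?; [left|right]; lra.
  - by case: B => ?; [left|right]; lra.
  - by case: A => ?; [left|right]; lra.
have lastE c : pathlen q M c = pathlen q M (last q M) + `|last q M - c|.
  by rewrite -{1}[M]cats0 pathlen_last.
rewrite (lastE c3) (lastE c4); have := pathlen_ge0 q M (last q M).
have := ler_distD q c1 c2; have := ler_distD (last q M) c3 c4.
rewrite (distrC q c2) (distrC c3 (last q M)) /two_largest !le_max => ? ? ?.
by split; apply/orP; [left|right|right]; lra.
Qed.

End FourPoints.

Section MetricGeodesics.
Context {R : realType} {T : metricType R}.
Implicit Types (a b e p : T).
Local Notation geodesic := (geodesic (@mdist R T)).

Let in_seg (l r : R) : 0 <= r -> r <= l -> r \in `[0, l].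
Proof. by move=> r0 rl; rewrite in_itv /= r0 rl. Qed.

Lemma geodesic_dist_l a b c r : geodesic a b c -> 0 <= r -> r <= mdist a b ->
  mdist a (c r) = r.
Proof.
move=> [c0 _ cd] r0 rab; rewrite -[X in mdist X _]c0 cd ?in_seg//; last exact: mdist_ge0.
by rewrite sub0r normrN ger0_norm.
Qed.

Lemma geodesic_dist_r a b c r : geodesic a b c -> 0 <= r -> r <= mdist a b ->
  mdist (c r) b = mdist a b - r.
Proof.
move=> [_ cl cd] r0 rab; rewrite -[X in mdist _ X]cl cd ?in_seg//; last exact: mdist_ge0.
by rewrite distrC ger0_norm// subr_ge0.
Qed.

(** The triangle inequality for the concatenated path cannot be strict anywhere,
    as it is an equality between the ends. *)
Lemma geodesic_cat a b e c1 c2 : geodesic a b c1 -> geodesic b e c2 ->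
  mdist a e = mdist a b + mdist b e -> exists c, geodesic a e c.
Proof.
move=> g1 g2 abe; have [c10 c1l c1d] := g1; have [c20 c2l c2d] := g2.
have ab0 := mdist_ge0 a b; have be0 := mdist_ge0 b e.
pose c r := if r <= mdist a b then c1 r else c2 (r - mdist a b).
have cle r : r \in `[0, mdist a e] -> mdist a (c r) <= r /\ mdist (c r) e <= mdist a e - r.
  rewrite in_itv /= => /andP[r0 rl]; rewrite /c; case: ifPn => [rab|]; last rewrite -ltNge => rab.
    rewrite (geodesic_dist_l g1)//; split=> //.
    have := metric_triangle (c1 r) b e; rewrite (geodesic_dist_r g1)//; lra.
  have r1 : 0 <= r - mdist a b by lra.
  have r2 : r - mdist a b <= mdist b e by lra.
  rewrite (geodesic_dist_r g2)//; split; last lra.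
  have := metric_triangle a b (c2 (r - mdist a b)); rewrite (geodesic_dist_l g2)//; lra.
exists c; split.
- by rewrite /c ab0.
- rewrite /c abe; case: ifPn => [h|_]; last by rewrite addrAC subrr add0r.
  have be : mdist b e = 0 by lra.
  by rewrite be addr0 c1l; exact: mdist_positivity.
suff H r r' : r \in `[0, mdist a e] -> r' \in `[0, mdist a e] -> r <= r' ->
    mdist (c r) (c r') = r' - r.
  move=> r r' rI r'I; have [rr|/ltW rr] := lerP r r'.
    by rewrite H// distrC ger0_norm// subr_ge0.
  by rewrite metric_sym H// ger0_norm// subr_ge0.
move=> rI r'I rr; have [ar re] := cle r rI; have [ar' re'] := cle r' r'I.
apply/eqP; rewrite eq_le; apply/andP; split; last first.
  have := metric_triangle a (c r) (c r'); have := metric_triangle a (c r') e; lra.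
move: rI r'I; rewrite !in_itv /= => /andP[r0 rl] /andP[r'0 rl'].
rewrite /c; case: ifPn => [h|]; last rewrite -ltNge => h.
  case: ifPn => [h'|]; last rewrite -ltNge => h'.
    by rewrite c1d ?in_seg// distrC ger0_norm ?subr_ge0.
  have e2 : mdist b (c2 (r' - mdist a b)) = r' - mdist a b.
    by apply: (geodesic_dist_l g2); lra.
  have := metric_triangle (c1 r) b (c2 (r' - mdist a b)).
  by rewrite e2 (geodesic_dist_r g1)//; lra.
rewrite ifN -?ltNge; last by lra.
rewrite c2d; [|by apply: in_seg; lra|by apply: in_seg; lra].
by rewrite distrC ger0_norm; lra.
Qed.

(** The points [p] and [c (mdist a p)] both lie between [a] and [b], at the same
    distance from [a], and the four-point condition makes their distance 0. *)
Lemma geodesic_between a b p c : delta_hyperbolic (@mdist R T) 0 ->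
  geodesic a b c -> mdist a p + mdist p b = mdist a b -> c (mdist a p) = p.
Proof.
move=> hyp g apb.
have ap0 := mdist_ge0 a p; have pb0 := mdist_ge0 p b.
have pab : mdist a p <= mdist a b by lra.
have e1 := geodesic_dist_l g ap0 pab; have e2 := geodesic_dist_r g ap0 pab.
have := hyp a p b (c (mdist a p)).
rewrite /gromov_product e1 (metric_sym b) e2 -apb subr0 ge_min => /orP h.
apply/esym/mdist_positivity/eqP; rewrite eq_le mdist_ge0 andbT.
by case: h; lra.
Qed.

End MetricGeodesics.

Section TreeDistance.
Context {R : realType} {L : finType} (color : L -> option bool).
Implicit Types (x : L) (u v w : seq L) (g h k : cox L) (s t r : R) (p q : cox L * R).

Definition posw w : seq R := map color_pos (colors color w).

(** The pair [(g, s)] stands for the translate by [g] of the point at distance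
    [s] from the first end of the fundamental edge. Letters of colour [false],
    resp. [true], fix the first, resp. the second end; the other letters fix the
    edge. *)
Definition tdist p q : R := pathlen p.2 (posw (p.1^-1 * q.1)%g) q.2.

Lemma posw_cat u v : posw (u ++ v) = posw u ++ posw v.
Proof. by rewrite /posw /colors pmap_cat map_cat. Qed.

Lemma posw_rev u : posw (rev u) = rev (posw u).
Proof. by rewrite /posw colors_rev map_rev. Qed.

Lemma tdistxx p : tdist p p = 0.
Proof. by rewrite /tdist mulVg /= subrr normr0. Qed.

Lemma tdistC p q : tdist p q = tdist q p.
Proof.
rewrite /tdist -pathlen_rev -posw_rev -wordV; congr (pathlen _ (posw (word _)) _).
by rewrite invgM invgK.
Qed.

Lemma pathlen_push s x w t : pathlen s (posw (push x w)) t <= pathlen s (posw (x :: w)) t.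
Proof.
case: w => //= y w; case: eqP => //= <-; rewrite /posw /colors /=.
case: (color x) => //= c; rewrite subrr normr0 add0r.
exact: (pathlen_triangle s [::] (color_pos c)).
Qed.

Lemma pathlen_rmul s u v t : pathlen s (posw (rmul u v)) t <= pathlen s (posw (u ++ v)) t.
Proof.
elim: u s => //= x u IH s; apply: le_trans (pathlen_push _ _ _ _) _.
by rewrite /posw /colors /=; case: (color x) => [c|] //=; rewrite ?lerD2l; exact: IH.
Qed.

Lemma tdist_triangle q p (r : cox L * R) : tdist p r <= tdist p q + tdist q r.
Proof.
rewrite /tdist; have -> : (p.1^-1 * r.1 = (p.1^-1 * q.1) * (q.1^-1 * r.1))%g by rewrite mulgA mulgK.
apply: le_trans (pathlen_rmul _ _ _ _) _; rewrite posw_cat.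
exact: pathlen_triangle.
Qed.

Definition translate k p : cox L * R := ((k * p.1)%g, p.2).

Lemma tdistM k p q : tdist (translate k p) (translate k q) = tdist p q.
Proof.
have E : ((k * p.1)^-1 * (k * q.1) = p.1^-1 * q.1)%g by rewrite invgM mulgA mulgVK.
exact: (congr1 (fun g => pathlen p.2 (posw (word g)) q.2) E).
Qed.

Lemma tdist_ldiv p q (c u v : seq L) : word p.1 = c ++ u -> word q.1 = c ++ v ->
  diverge u v -> tdist p q = pathlen p.2 (rev (posw u) ++ posw v) q.2.
Proof. by move=> pE qE d; rewrite /tdist (word_ldiv pE qE d) posw_cat posw_rev. Qed.

(** In the Cayley tree, the path [m] separates the vertices [1] and [p3.1] from
    [p1.1] and [p2.1]. *)
Lemma two_largest_tripod s p1 p2 p3 (c m u1 u2 u3 : seq L) :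
  word p1.1 = c ++ m ++ u1 -> word p2.1 = c ++ m ++ u2 -> word p3.1 = c ++ u3 ->
  diverge u1 u2 -> diverge (m ++ u1) u3 -> diverge (m ++ u2) u3 ->
  let o : cox L * R := (1%g, s) in
  two_largest (tdist o p3 + tdist p1 p2) (tdist o p1 + tdist p3 p2) (tdist o p2 + tdist p3 p1).
Proof.
move=> E1 E2 E3 d12 d13 d23 o.
have dO q : tdist o q = pathlen s (posw q.1) q.2 by rewrite /tdist invg1 mul1g.
rewrite !dO E1 E2 E3 (tdist_ldiv (etrans E1 (catA _ _ _)) (etrans E2 (catA _ _ _)) d12).
rewrite (tdist_ldiv E3 E2) 1?divergeC// (tdist_ldiv E3 E1) 1?divergeC//.
rewrite !posw_cat -{1 2}[posw c]revK.
by have := four_arms (rev (posw c)) s (posw u3) p3.2 (posw u1) p1.2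
  (posw u2) p2.2 (posw m); rewrite !revK.
Qed.

(** In the Cayley tree, some path separates two of the four vertices from the
    two others; which ones is decided by the common prefixes. *)
Lemma tdist_two_largest p p1 p2 p3 :
  two_largest (tdist p p3 + tdist p1 p2) (tdist p p1 + tdist p3 p2) (tdist p p2 + tdist p3 p1).
Proof.
wlog p1E : p p1 p2 p3 / p.1 = 1%g.
  move=> H; have := H (translate p.1^-1%g p) (translate p.1^-1%g p1)
    (translate p.1^-1%g p2) (translate p.1^-1%g p3).
  by rewrite !tdistM; apply; rewrite /= mulVg.
have -> : p = (1%g, p.2) by rewrite -p1E; case: (p).
have [c' [u1 [u2 [E1 E2 d12]]]] := common_prefix p1.1 p2.1.
have [c [m [u3 [Ec E3 dm3]]]] := common_prefix c' p3.1.
rewrite {c'}Ec -!catA in E1 E2.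
have [m0|m0] := eqVneq m [::]; last first.
  by apply: two_largest_tripod E1 E2 E3 d12 _ _; rewrite diverge_catl.
rewrite {}m0 /= in E1 E2 dm3.
have perm1 (x y z : R) : two_largest x y z -> two_largest y x z.
  by case=> ? ? ?; split=> //; rewrite maxC.
have perm2 (x y z : R) : two_largest x y z -> two_largest x z y.
  by case=> ? ? ?; split=> //; rewrite maxC.
have [m1 [v1 [v3 [F1 F3 d13]]]] := common_prefix u1 u3.
have [m10|m10] := eqVneq m1 [::]; last first.
  subst u1 u3; have [q1 q2] : diverge (m1 ++ v1) u2 /\ diverge (m1 ++ v3) u2.
    by move: d12; rewrite !diverge_catl.
  have := two_largest_tripod p.2 E1 E3 E2 d13 q1 q2.
  by rewrite (tdistC p1 p3) (tdistC p2 p3) (tdistC p2 p1) => /perm1/perm2/perm1.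
subst m1; rewrite /= in F1 F3; subst v1 v3.
have [m2 [v2 [v3 [F2 F3 d23]]]] := common_prefix u2 u3.
have [m20|m20] := eqVneq m2 [::]; last first.
  subst u2 u3; have [q1 q2] : diverge (m2 ++ v2) u1 /\ diverge (m2 ++ v3) u1.
    by rewrite !(divergeC _ u1); move: d12 d13; rewrite !diverge_catr.
  have := two_largest_tripod p.2 E2 E3 E1 d23 q1 q2.
  by rewrite (tdistC p1 p3) (tdistC p2 p3) => /perm2/perm1.
subst m2; rewrite /= in F2 F3; subst v2 v3.
exact: (@two_largest_tripod p.2 p1 p2 p3 c [::]) E1 E2 E3 d12 d13 d23.
Qed.

Lemma tdist_hyperbolic : delta_hyperbolic tdist 0.
Proof.
move=> p x y z; rewrite subr0 ge_min /gromov_product.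
have [_ _] := tdist_two_largest p x y z; rewrite le_max (tdistC z x) => /orP[h|h].
  by apply/orP; left; lra.
by apply/orP; right; rewrite (tdistC y z); lra.
Qed.

End TreeDistance.

Section Tree.
Context {R : realType} {L : finType}.
Implicit Types (g h k : cox L) (s t r : R) (p q : cox L * R).

(** The points at distance 0 from a given one form its class. The classes of
    pairs with the same parameter [s] form the orbit of a point of the
    fundamental edge. *)
Definition tree_carrier (color : L -> option bool) : Type := {A : set (cox L * R) |
  exists2 p, 0 <= p.2 <= 1 & A = [set q | tdist color p q = 0]}.

Variable color : L -> option bool.
Local Notation tdist := (tdist color).
Local Notation tree := (tree_carrier color).
Implicit Types a b : tree.

HB.instance Definition _ := gen_eqMixin tree.
HB.instance Definition _ := gen_choiceMixin tree.

Definition trep a : cox L * R := sval (cid2 (svalP a)).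

Lemma trep01 a : 0 <= (trep a).2 <= 1.
Proof. by rewrite /trep; case: cid2. Qed.

Lemma sval_tree a : sval a = [set q | tdist (trep a) q = 0].
Proof. by rewrite /trep; case: cid2. Qed.

(** It makes [tpoint] total, as geodesics are functions on the whole real line. *)
Definition clamp s : R := Num.max 0 (Num.min s 1).

Lemma clamp01 s : 0 <= clamp s <= 1.
Proof. by rewrite /clamp le_max lexx /= ge_max ler01 ge_min lexx orbT. Qed.

Lemma clamp_id s : 0 <= s <= 1 -> clamp s = s.
Proof. by move=> /andP[s0 s1]; rewrite /clamp (min_idPl s1) (max_idPr s0). Qed.

Definition tpoint g s : tree := exist _ [set q | tdist (g, clamp s) q = 0]
  (ex_intro2 _ _ (g, clamp s) (clamp01 s) erefl).

Definition mdistT a b : R := tdist (trep a) (trep b).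

Lemma tdist0_eq p q (r : cox L * R) : tdist p q = 0 -> tdist p r = tdist q r.
Proof.
move=> E; apply/eqP; rewrite eq_le; apply/andP; split.
  by have := tdist_triangle color q p r; rewrite E add0r.
by have := tdist_triangle color p q r; rewrite (tdistC _ q p) E add0r.
Qed.

Lemma tree_eqP a b : mdistT a b = 0 -> a = b.
Proof.
move=> E; apply: sval_inj; rewrite !sval_tree; apply/seteqP; split=> q /=;
  by rewrite (tdist0_eq q E).
Qed.

Lemma trep_tpoint g s : 0 <= s <= 1 -> tdist (g, s) (trep (tpoint g s)) = 0.
Proof.
move=> s01; have : sval (tpoint g s) (trep (tpoint g s)).
  by rewrite sval_tree /= tdistxx.
by rewrite /= clamp_id.
Qed.

Lemma mdistT_tpoint g s h t : 0 <= s <= 1 -> 0 <= t <= 1 ->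
  mdistT (tpoint g s) (tpoint h t) = tdist (g, s) (h, t).
Proof.
move=> s01 t01; rewrite /mdistT -(tdist0_eq _ (trep_tpoint g s01)).
by rewrite tdistC -(tdist0_eq _ (trep_tpoint h t01)) tdistC.
Qed.

Lemma tpointP a : exists g s, 0 <= s <= 1 /\ a = tpoint g s.
Proof.
exists (trep a).1, (trep a).2; split; first exact: trep01.
by apply: sval_inj; rewrite sval_tree /= clamp_id ?trep01//; case: (trep a).
Qed.

Let mdistTxx a : mdistT a a = 0. Proof. exact: tdistxx. Qed.
Let mdistTC a b : mdistT a b = mdistT b a. Proof. exact: tdistC. Qed.
Let mdistT_triangle b a (c : tree) : mdistT a c <= mdistT a b + mdistT b c.
Proof. exact: tdist_triangle. Qed.

HB.instance Definition _ := isMetric.Build R tree mdistTxx tree_eqP mdistTC mdistT_triangle.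

End Tree.

(** * The action on the tree *)

Section TreeAction.
Context {R : realType} {L : finType} (color : L -> option bool).
Implicit Types (x : L) (g h k : cox L) (s t r : R) (w : seq L).

Local Notation tree := (@tree_carrier R L color).
Local Notation tpoint := (@tpoint R L color).
Local Notation posw := (@posw R L color).
Local Notation tdist := (@tdist R L color).
Local Notation geodesic := (geodesic (@mdist R tree)).
Implicit Types a b : tree.

Definition tact g a : tree := tpoint (g * (trep a).1)%g (trep a).2.

Lemma mdist_tpoint g s h t : 0 <= s <= 1 -> 0 <= t <= 1 ->
  mdist (tpoint g s) (tpoint h t) = tdist (g, s) (h, t).
Proof. exact: mdistT_tpoint. Qed.

Lemma tpoint_eq g s h t : 0 <= s <= 1 -> 0 <= t <= 1 ->
  tdist (g, s) (h, t) = 0 -> tpoint g s = tpoint h t.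
Proof. by move=> s01 t01 E; apply: mdist_positivity; rewrite mdist_tpoint. Qed.

Lemma tact_tpoint g h s : 0 <= s <= 1 -> tact g (tpoint h s) = tpoint (g * h)%g s.
Proof.
move=> s01; apply: tpoint_eq => //; first exact: trep01.
transitivity (tdist (trep (tpoint h s)) (h, s)); last by rewrite tdistC trep_tpoint.
exact: (tdistM color g (trep (tpoint h s)) (h, s)).
Qed.

Lemma tdist_mul g k s t : tdist (g, s) ((g * k)%g, t) = pathlen s (posw k) t.
Proof. exact: (congr1 (fun k' => pathlen s (posw (word k')) t) (mulKg g k)). Qed.

Lemma tdist_same g s t : tdist (g, s) (g, t) = `|s - t|.
Proof. by rewrite -{2}(mulg1 g) tdist_mul. Qed.

Lemma tact_isometric : isometric_action tact.
Proof.
split=> [a|g h a|g a b].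
- by have [k [s [s01 ->]]] := tpointP a; rewrite tact_tpoint// mul1g.
- by have [k [s [s01 ->]]] := tpointP a; rewrite !tact_tpoint// mulgA.
- have [k [s [s01 ->]]] := tpointP a; have [l [t [t01 ->]]] := tpointP b.
  by rewrite !tact_tpoint// !mdist_tpoint// (tdistM color g (k, s) (l, t)).
Qed.

Lemma color_pos01 c : 0 <= (color_pos c : R) <= 1.
Proof. by case: c; rewrite /color_pos /= ?ler01 lexx. Qed.

Lemma tpoint_color g x c : color x = Some c ->
  tpoint g (color_pos c) = tpoint (g * gen x)%g (color_pos c).
Proof.
move=> cx; apply: tpoint_eq; [exact: color_pos01|exact: color_pos01|].
by rewrite tdist_mul /posw /colors /= cx /= !subrr !normr0 addr0.
Qed.

Lemma tpoint_neutral g x s : color x = None -> 0 <= s <= 1 ->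
  tpoint g s = tpoint (g * gen x)%g s.
Proof.
move=> cx s01; apply: tpoint_eq => //.
by rewrite tdist_mul /posw /colors /= cx /= subrr normr0.
Qed.

Lemma mdist_mul g w s t : reduced w -> 0 <= s <= 1 -> 0 <= t <= 1 ->
  mdist (tpoint g s) (tpoint (g * of_word w)%g t) = pathlen s (posw w) t.
Proof. by move=> rw s01 t01; rewrite mdist_tpoint// tdist_mul of_word_red. Qed.

Definition edge_path g s t : R -> tree := fun r => tpoint g (if s <= t then s + r else s - r).

Lemma edge_geodesic g s t : 0 <= s <= 1 -> 0 <= t <= 1 ->
  geodesic (tpoint g s) (tpoint g t) (edge_path g s t).
Proof.
move=> s01 t01; have d r r' : 0 <= r <= 1 -> 0 <= r' <= 1 ->
    mdist (tpoint g r) (tpoint g r') = `|r - r'|.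
  by move=> r01 r'01; rewrite mdist_tpoint// tdist_same.
rewrite /edge_path; move: (s01) (t01) => /andP[s0 s1] /andP[t0 t1]; split.
- by rewrite addr0 subr0 if_same.
- by rewrite d//; case: ifPn => [st|]; [|rewrite -ltNge => st]; congr tpoint;
    [rewrite distrC|]; rewrite ger0_norm; lra.
- rewrite d// => r r'; rewrite !in_itv /= => /andP[r0 rl] /andP[r'0 rl'].
  have [st|st] := lerP s t.
    rewrite distrC ger0_norm ?subr_ge0// in rl rl'.
    rewrite d; [|by apply/andP; split; lra|by apply/andP; split; lra].
    by congr (`|_|); lra.
  rewrite ger0_norm ?subr_ge0 ?(ltW st)// in rl rl'.
  rewrite d; [|by apply/andP; split; lra|by apply/andP; split; lra].
  by rewrite distrC; congr (`|_|); lra.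
Qed.

(** A geodesic follows the coloured letters of [w] one at a time; the distance
    adds up along the way by definition. *)
Lemma word_geodesic w g s t : reduced w -> 0 <= s <= 1 -> 0 <= t <= 1 ->
  exists c, geodesic (tpoint g s) (tpoint (g * of_word w)%g t) c.
Proof.
elim: w g s => [|x w IH] g s rw s01 t01.
  by exists (edge_path g s t); rewrite /of_word big_nil mulg1; exact: edge_geodesic.
have rw' : reduced w by move: rw; rewrite reduced_cons => /andP[].
have ofE : (g * of_word (x :: w) = g * gen x * of_word w)%g by rewrite /of_word big_cons mulgA.
case cx: (color x) => [c|]; last first.
  by rewrite ofE (tpoint_neutral g cx s01); exact: IH.
have c01 := color_pos01 c.
have [c2 c2P] := IH (g * gen x)%g (color_pos c) rw' c01 t01.
have c1P := edge_geodesic g s01 c01.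
rewrite -(tpoint_color g cx) -ofE in c2P; apply: geodesic_cat c1P c2P _.
rewrite (mdist_mul g rw s01 t01) (tpoint_color g cx) ofE (mdist_mul _ rw' c01 t01).
rewrite -(tpoint_color g cx) mdist_tpoint// tdist_same.
by rewrite /posw /colors /= cx.
Qed.

Lemma tree_Rtree : Rtree tree.
Proof.
split=> [a b _ _|p a b c]; last exact: tdist_hyperbolic.
have [g [s [s01 ->]]] := tpointP a; have [h [t [t01 ->]]] := tpointP b.
have [c] := word_geodesic g (word_reduced (g^-1 * h)%g) s01 t01.
by rewrite of_wordK mulVKg => cP; exists c.
Qed.

(** The edges [g xa] and [g xb] are attached to the two ends of the edge [g], so
    the geodesic between a point of the one and a point of the other runs
    through the whole of [g]. *)
Lemma tact_minimal xa xb : color xa = Some false -> color xb = Some true ->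
  minimal_action tact.
Proof.
move=> ca cb A subA [p Ap] invA; apply/seteqP; split=> // z _.
have [h0 [s [s01 pE]]] := tpointP p; have [g [t [t01 ->]]] := tpointP z.
have As h : A (tpoint h s).
  apply: (invA (h * h0^-1)%g); exists p => //.
  by rewrite pE tact_tpoint// mulgVK.
have [c cP cA] := subA _ _ (As (g * gen xa)%g) (As (g * gen xb)%g).
have ab : xa != xb by apply/eqP => E; move: ca; rewrite E cb.
have d1 : mdist (tpoint (g * gen xa)%g s) (tpoint g t) = s + t.
  rewrite mdist_tpoint// tdistC tdist_mul /posw /colors /= ca /= (addrC s).
  by rewrite subr0 sub0r normrN !ger0_norm//; move: s01 t01 => /andP[? ?] /andP[? ?].
have d2 : mdist (tpoint g t) (tpoint (g * gen xb)%g s) = (1 - t) + (1 - s).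
  rewrite mdist_tpoint// tdist_mul /posw /colors /= cb /= /color_pos /=.
  move: s01 t01 => /andP[? ?] /andP[? ?].
  by rewrite distrC !ger0_norm//; lra.
have d3 : mdist (tpoint (g * gen xa)%g s) (tpoint (g * gen xb)%g s) = 2.
  have -> : (g * gen xb = g * gen xa * (gen xa * gen xb))%g.
    by rewrite !mulgA -{2}(genV xa) mulgK.
  rewrite mdist_tpoint// tdist_mul word_genM /= (negPf ab) /posw /colors /= ca cb /= /color_pos /=.
  move: s01 => /andP[? ?].
  by rewrite subr0 sub0r normrN normr1 !ger0_norm//; lra.
rewrite -(geodesic_between (p := tpoint g t) tree_Rtree.2 cP); last first.
  by rewrite d1 d2 d3; lra.
by apply: cA; exists (mdist (tpoint (g * gen xa)%g s) (tpoint g t)) => //=;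
  rewrite in_itv /= mdist_ge0 d1 d3; move: s01 t01 => /andP[? ?] /andP[? ?]; lra.
Qed.

End TreeAction.

(** * Subgroups that are not virtually cyclic *)

Section NotVirtuallyCyclic.
Context {L : finType}.
Implicit Types (x : L) (g h : cox L) (w : seq L).

(** Two powers of [y] lie in the same coset. *)
Lemma power_in_cyclic (H : set (cox L)) g y : (forall n, H (y ^+ n)%g) ->
  finite_set [set left_coset (cyclic_subgroup g) k | k in H] ->
  exists n, cyclic_subgroup g (y ^+ n.+1)%g.
Proof.
move=> Hy fin; pose f n := left_coset (cyclic_subgroup g) (y ^+ n)%g.
have [i [j [ij E]]] : exists i j, (i < j)%N /\ f i = f j.
  apply: contrapT => /forallNP inj; apply: infinite_nat.
  have fI : injective f.
    move=> i j E; apply/eqP; apply: contrapT => /negP; rewrite neq_ltn => /orP[ij|ji].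
      by apply: (inj i); exists j.
    by apply: (inj j); exists i.
  have <- : f @^-1` [set left_coset (cyclic_subgroup g) k | k in H] = setT.
    by apply/seteqP; split=> // n _; exists (y ^+ n)%g.
  by apply: finite_preimage fin => i j _ _; exact: fI.
exists (j - i).-1; rewrite prednK ?subn_gt0//.
by move/left_cosetP: E; rewrite -{1}(subnKC (ltnW ij)) expgnDr mulKg.
Qed.

Lemma cyclic_commute (G : groupType) (g a b : G) :
  cyclic_subgroup g a -> cyclic_subgroup g b -> (a * b = b * a)%g.
Proof.
have cX m n : commute (g ^+ m)%g (g ^+ n)%g by apply: commuteX2.
move=> [m [->|->]] [n [->|->]].
- exact: cX.
- exact/commuteV/cX.
- exact/commute_sym/commuteV/cX.
- exact/commuteV/commute_sym/commuteV/cX.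
Qed.

Lemma of_wordX w n : (of_word w ^+ n)%g = of_word (flatten (nseq n w)).
Proof.
elim: n => [|n IH] /=; first by rewrite expg0 /of_word big_nil.
by rewrite expgS IH of_word_cat.
Qed.

(** Two powers of one element would commute, but the reduced words below differ
    at their second letters. *)
Lemma not_virtually_cyclic (H : set (cox L)) x1 x2 x3 :
  x1 != x2 -> x1 != x3 -> x2 != x3 ->
  (forall n, H (of_word [:: x1; x2] ^+ n)%g) ->
  (forall n, H (of_word [:: x1; x3] ^+ n)%g) -> ~ virtually_cyclic H.
Proof.
move=> n12 n13 n23 H2 H3 [g Hg fin].
have [m gm] := power_in_cyclic H2 fin; have [n gn] := power_in_cyclic H3 fin.
have cmt := cyclic_commute gm gn.
have red x k w : x1 != x -> reduced (x1 :: w) ->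
    reduced (flatten (nseq k [:: x1; x]) ++ x1 :: w).
  move=> x1x rw; elim: k => //= k IH.
  by rewrite !reduced_cons IH andbT /= x1x; case: (k) => [|l] /=; rewrite eq_sym x1x.
have red1 x k : x1 != x -> reduced (x1 :: x :: flatten (nseq k [:: x1; x])).
  move=> x1x; elim: k => [|k IH]; first by rewrite /reduced /= x1x.
  by rewrite /= reduced_cons (reduced_cons x) IH /= x1x eq_sym x1x.
move: cmt; rewrite !of_wordX -!of_word_cat => /(congr1 (@word L)).
rewrite !of_word_red; [|exact: red n13 (red1 _ _ n12)|exact: red n12 (red1 _ _ n13)].
by move=> /= [E]; rewrite E eqxx in n23.
Qed.

End NotVirtuallyCyclic.

(** * Edge stabilizers and translation lengths *)

Section StableLength.
Context {R : realType} {L : finType} (color : L -> option bool).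
Implicit Types (x : L) (g h z : cox L) (s t r : R) (w : seq L).

Local Notation tree := (@tree_carrier R L color).
Local Notation tpoint := (@tpoint R L color).
Local Notation tact := (@tact R L color).

Lemma tpoint_neutral_word g w s : {in w, forall x, color x = None} -> 0 <= s <= 1 ->
  tpoint g s = tpoint (g * of_word w)%g s.
Proof.
move=> nw s01; elim: w g nw => [|x w IH] g nw; first by rewrite /of_word big_nil mulg1.
rewrite /of_word big_cons mulgA -IH; last by move=> y yw; apply: nw; rewrite inE yw orbT.
by apply: tpoint_neutral => //; apply: nw; exact: mem_head.
Qed.

(** Words in neutral letters fix the fundamental edge pointwise. *)
Lemma tact_not_small x1 x2 x3 : x1 != x2 -> x1 != x3 -> x2 != x3 ->
  color x1 = None -> color x2 = None -> color x3 = None -> ~ small_action tact.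
Proof.
move=> n12 n13 n23 c1 c2 c3.
have z01 : 0 <= (0 : R) <= 1 by rewrite lexx ler01.
have o01 : 0 <= (1 : R) <= 1 by rewrite lexx ler01.
have gP := edge_geodesic color 1%g z01 o01.
set I := geodesic_image (@mdist R tree) (tpoint 1%g 0) (tpoint 1%g 1) (edge_path color 1%g 0 1).
have d01 : mdist (tpoint 1%g 0) (tpoint 1%g 1) = 1.
  by rewrite mdist_tpoint// tdist_same sub0r normrN normr1.
have fixI w a : {in w, forall x, color x = None} -> I a -> tact (of_word w) a = a.
  move=> nw [r]; rewrite /= in_itv /= d01 => r01 <-.
  by rewrite /edge_path ler01 add0r tact_tpoint// mulg1 [RHS](tpoint_neutral_word 1%g nw)// mul1g.
have stabI w n : {in w, forall x, color x = None} -> stabilizer tact I (of_word w ^+ n)%g.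
  move=> nw; rewrite of_wordX.
  have nw' : {in flatten (nseq n w), forall x, color x = None}.
    by move=> x /flattenP[w' /nseqP[-> _]]; exact: nw.
  by apply/seteqP; split=> [_ [a Ia <-]|a Ia]; [rewrite fixI|exists a => //; exact: fixI].
have nw2 : {in [:: x1; x2], forall x, color x = None}.
  by move=> x; rewrite !inE => /orP[] /eqP->.
have nw3 : {in [:: x1; x3], forall x, color x = None}.
  by move=> x; rewrite !inE => /orP[] /eqP->.
have seg : segment_nd (@mdist R tree) I.
  exists (tpoint 1%g 0), (tpoint 1%g 1), (edge_path color 1%g 0 1); split=> //.
  by move=> E; move: d01; rewrite E mdistxx => /eqP; rewrite eq_sym oner_eq0.
move=> /(_ I seg); apply: (not_virtually_cyclic n12 n13 n23) => n.
  exact: stabI nw2.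
exact: stabI nw3.
Qed.

Lemma word_power z n : diverge (rev z) z -> word z != [::] ->
  word (z ^+ n)%g = flatten (nseq n (word z)).
Proof.
move=> dz z0; rewrite -{1}(of_wordK z) of_wordX of_word_red//.
elim: n => // n IH; rewrite /= reduced_cat word_reduced IH.
by case: n {IH} => [|n]; [rewrite diverges0|rewrite diverge_catr].
Qed.

(** At this point of the axis, the path of [z ^+ n] is the closed path of [z]
    traversed [n] times. *)
Lemma translation_orbit h z n : let q := tpoint h (color_pos (last false (colors color z))) in
  diverge (rev z) z -> word z != [::] ->
  mdist q (tact ((h * z * h^-1) ^+ n)%g q) = n%:R * cyclic_length color z.
Proof.
move=> q dz z0; rewrite /q axisX tact_tpoint ?color_pos01// mulgVK.
rewrite mdist_tpoint ?color_pos01// tdist_mul word_power//.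
have -> : posw color (flatten (nseq n (word z))) = flatten (nseq n (@posw R L color z)).
  by elim: n => //= n IH; rewrite posw_cat IH.
rewrite pathlen_power// /posw last_map; congr color_pos.
by case/lastP: (colors color z) => // u c; rewrite !last_rcons.
Qed.

Lemma stable_length_axis h z (p : tree) : diverge (rev z) z -> word z != [::] ->
  stable_length tact p (h * z * h^-1)%g = cyclic_length color z.
Proof.
move=> dz z0; rewrite /stable_length; apply/cvg_lim => //.
set x := (h * z * h^-1)%g; set N := cyclic_length color z.
pose q := tpoint h (color_pos (last false (colors color z))).
have [_ _ iso] := @tact_isometric R L color.
have bound n : `|mdist p (tact (x ^+ n)%g p) - n%:R * N| <= 2 * mdist p q.
  have := translation_orbit h n dz z0; rewrite -/q -/x -/N => <-.
  have := metric_triangle p q (tact (x ^+ n)%g p).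
  have := metric_triangle q (tact (x ^+ n)%g q) (tact (x ^+ n)%g p).
  have := metric_triangle q p (tact (x ^+ n)%g q).
  have := metric_triangle p (tact (x ^+ n)%g p) (tact (x ^+ n)%g q).
  rewrite !iso (metric_sym q p) ler_norml => ? ? ? ?; apply/andP; split; lra.
apply/cvgrPdist_le => eps eps0.
exists (Num.truncn (2 * mdist p q / eps)).+1 => // n /= Cn.
have n0 : 0 < n%:R :> R by rewrite ltr0n; apply: leq_trans Cn.
have -> : N - mdist p (tact (x ^+ n)%g p) / n%:R =
    - ((mdist p (tact (x ^+ n)%g p) - n%:R * N) / n%:R).
  by rewrite mulrBl mulrAC divff ?gt_eqF// mul1r opprB.
rewrite normrN normrM normfV (ger0_norm (ltW n0)) ler_pdivrMr// (le_trans (bound n))//.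
rewrite -ler_pdivrMl// mulrC; apply: ltW; apply: lt_le_trans (truncnS_gt _) _.
by rewrite ler_nat.
Qed.

End StableLength.

(** * The example *)

(** Colours determine the coloured letters: a line which passed from one letter
    of colour [false] to another would be counted once instead of twice. *)
Lemma stable_length_extends (R : realType) (L : finType) (color : L -> option bool)
    (x0 : L) (e0 : boundary2 R (@gens L)) :
  (forall x y b, color x = Some b -> color y = Some b -> x = y) ->
  extends_to_currents (@tact R L color) (@gens L).
Proof.
move=> cinj; exists e0, (crossing_mass color); split; first exact: crossing_mass_continuous.
move=> la x la0 tx; have [h [z [xE z0 dz]]] := cyclically_reduced tx.
exists (rational_current (e0 := e0) x0 h z0 dz la0).
  by rewrite xE; exact: rational_currentP.
move=> p; rewrite crossing_mass_rational xE stable_length_axis//; congr (_ * _).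
apply: cyclic_length_crossing => //.
by rewrite reduced_cat word_reduced.
Qed.

(** The two coloured letters fix one end of the fundamental edge each; the three
    neutral ones fix the edge, and three are needed for the stabilizer not to be
    virtually cyclic. *)
Definition letter : finType := (bool + 'I_3)%type.

Definition letter_color (x : letter) : option bool := if x is inl b then Some b else None.

Lemma letter_color_inj x y b :
  letter_color x = Some b -> letter_color y = Some b -> x = y.
Proof. by case: x y => [c|i] [d|j] //= [->] [->]. Qed.

Theorem theorem1p8 (R : realType) :
  exists (G : groupType) (S : seq G),
    [/\ hyperbolic_group R S,
        ~ virtually_cyclic [set: G]%classic &
        exists (T : metricType R) (to : G -> T -> T),
          [/\ Rtree T, isometric_action to, minimal_action to,
              ~ small_action to & extends_to_currents to S]].
Proof.
pose a : letter := inl false; pose b : letter := inl true.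
pose c (i : 'I_3) : letter := inr i.
have c01 : c (inord 0) != c (inord 1) by rewrite (inj_eq (@inr_inj _ _)) -val_eqE /= !inordK.
have c02 : c (inord 0) != c (inord 2) by rewrite (inj_eq (@inr_inj _ _)) -val_eqE /= !inordK.
have c12 : c (inord 1) != c (inord 2) by rewrite (inj_eq (@inr_inj _ _)) -val_eqE /= !inordK.
exists (cox letter), gens; split.
- exact: cayley_tree_hyperbolic.
- exact: (not_virtually_cyclic c01 c02 c12).
exists (tree_carrier letter_color), (@tact R letter letter_color); split.
- exact: tree_Rtree.
- exact: tact_isometric.
- exact: (@tact_minimal _ _ _ a b).
- exact: (tact_not_small c01 c02 c12).
(* The axis of [a b] serves as the distinguished line. *)
pose z : cox letter := Cox [:: a; b] isT.
apply: (stable_length_extends a (@axis0 R letter a z isT isT)).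
exact: letter_color_inj.
Qed.
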